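(* Let $G$ be a unicyclic graph of order $m\geq 3$ and let $H$ be a connected graph of order $n$. Then $p(G\Box H)\leq \frac{mn}{2}$.
   Context: All graphs are finite, undirected and simple; the order of a graph is its number of vertices. A unicyclic graph is a connected graph whose number of edges equals its number of vertices. A path decomposition of a graph $X$ is a collection of pairwise edge-disjoint paths of $X$ that together cover all edges of $X$; $p(X)$ denotes the minimum number of paths in a path decomposition of $X$. The cartesian product $G\Box H$ has vertex set $V(G)\times V(H)$, and $(u_1,v_1)$, $(u_2,v_2)$ are adjacent if and only if either $u_1u_2\in E(G)$ and $v_1=v_2$, or $v_1v_2\in E(H)$ and $u_1=u_2$.
   Formalization: The case m = 3, n = 1 (G a triangle, H a single vertex) is excluded: there the product is a triangle, which needs 2 paths, while mn/2 = 3/2, so the claim as stated fails in exactly that case. *)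

(* Defs.v *)
From mathcomp Require Import all_boot.
From mathcomp Require Import boolp.

Set Implicit Arguments.
Unset Strict Implicit.
Unset Printing Implicit Defensive.

Record sgraph := SGraph {
  vertex :> finType;
  adj : rel vertex;
  adj_sym : symmetric adj;
  adj_irrefl : irreflexive adj }.

Definition edge_set (X : sgraph) : {set {set X}} :=
  [set [set xy.1; xy.2] | xy : X * X & adj xy.1 xy.2].

Definition connected_graph (X : sgraph) : Prop :=
  0 < #|X| /\ forall x y : X, connect (@adj X) x y.

Definition unicyclic (X : sgraph) : Prop :=
  connected_graph X /\ #|edge_set X| = #|X|.

(* A path is given by the sequence of its vertices. *)
Definition is_path (X : sgraph) (s : seq X) : bool :=
  [&& s != [::], uniq s & sorted (@adj X) s].

Definition path_edges (X : sgraph) (s : seq X) : {set {set X}} :=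
  [set [set xy.1; xy.2] | xy in zip s (behead s)].

Definition path_decomposition (X : sgraph) (D : seq (seq X)) : Prop :=
  [/\ all (@is_path X) D,
      pairwise (fun s t => [disjoint path_edges s & path_edges t]) D &
      \bigcup_(s <- D) path_edges s = edge_set X].

Definition has_decomposition_of_size (X : sgraph) (k : nat) : Prop :=
  exists2 D : seq (seq X), path_decomposition D & size D = k.

Lemma edge_enumP (X : sgraph) (A : {set X}) : A \in edge_set X ->
  is_path (enum A) /\ path_edges (enum A) = [set A].
Proof.
case/imsetP=> -[x y] /=; rewrite inE /= => exy defA.
have nxy : x != y by apply: contraTneq exy => ->; rewrite adj_irrefl.
have: size (enum A) = 2 by rewrite -cardE defA cards2 nxy.
have := mem_enum A; have := enum_uniq A.
case: (enum A) => [|a [|b [|c s]]] //= /[!inE] /[!andbT] nab memA _.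
have defA' : A = [set a; b] by apply/setP=> z; rewrite -memA !inE.
have eab : adj a b.
  have := memA a; have := memA b; rewrite defA !inE !eqxx orbT /=.
  move=> /esym/orP[]/eqP eqb /esym/orP[]/eqP eqa; move: nab exy;
    rewrite eqa eqb ?eqxx //; by rewrite adj_sym.
split; first by rewrite /is_path /= inE nab eab.
apply/setP=> B; rewrite !inE; apply/imsetP/eqP => [[z]|->].
  by rewrite inE => /eqP -> ->; rewrite defA'.
by exists (a, b); rewrite ?inE.
Qed.

Lemma has_decompositionP (X : sgraph) :
  exists k, `[< has_decomposition_of_size X k >].
Proof.
pose D := [seq enum (A : {set X}) | A <- enum (edge_set X)].
exists (size D); apply/asboolP; exists D => //; split.
- by apply/allP=> s /mapP[A]; rewrite mem_enum => /edge_enumP[? _] ->.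
- rewrite pairwise_map.
  apply: (@sub_in_pairwise _ (mem (edge_set X)) (fun A B => A != B)).
  + move=> A B /edge_enumP[_ eA] /edge_enumP[_ eB] nAB /=.
    by rewrite eA eB disjoints1 inE.
  + by apply/allP=> A; rewrite mem_enum.
  + by rewrite -uniq_pairwise enum_uniq.
- rewrite big_map big_enum /=; apply/setP=> B; apply/bigcupP/idP.
    by case=> A EA; rewrite (edge_enumP EA).2 inE => /eqP->.
  by move=> EB; exists B; rewrite // (edge_enumP EB).2 inE.
Qed.

Definition path_number (X : sgraph) : nat := ex_minn (has_decompositionP X).

Definition cart_adj (G H : sgraph) : rel (G * H) :=
  fun u v => (adj u.1 v.1 && (u.2 == v.2)) || (adj u.2 v.2 && (u.1 == v.1)).

Lemma cart_adj_sym (G H : sgraph) : symmetric (@cart_adj G H).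
Proof.
move=> [a b] [c d]; rewrite /cart_adj /=.
by rewrite (adj_sym a) (adj_sym b) (eq_sym a) (eq_sym b).
Qed.

Lemma cart_adj_irrefl (G H : sgraph) : irreflexive (@cart_adj G H).
Proof. by move=> u; rewrite /cart_adj !adj_irrefl. Qed.

Definition cart_prod (G H : sgraph) : sgraph :=
  SGraph (@cart_adj_sym G H) (@cart_adj_irrefl G H).

(* Main.v *)
(** Orient the unicyclic graph [G] by a map [f] so that its edges are the pairs
    {g, f g}, once each; then every vertex (g, h) of the product owns the column
    edge towards (f g, h), and there is one path available for two such edges.

    By rotating path ends around a vertex, [H] is decomposed into paths so that
    one path ends at each vertex of odd degree and two at each vertex of even
    degree. Joined at the vertices of even degree, the paths form trails
    A_1, ..., A_k whose break points, together with the ends of the open trails,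
    are all the vertices of [H], once each. It remains to decompose, for each
    trail, its copies at all levels together with the columns of its vertices,
    with m/2 paths per vertex. A path A ending at x and a path B from x to y
    give m paths: extend the copies of A and B by the column edges at x and y,
    and pair the copies that arrive at the same vertex at levels g, g' with
    f g = f g'; an unpaired copy of A arriving at level v is joined to the copy
    of B at level v. This handles an even number of vertices. An odd closed
    trail is treated cyclically if [G] is not a cycle, and by paths climbing
    through four consecutive levels if [G] is a cycle of length at least 4; the
    triangle needs separate patterns. *)

Require Import Defs.
From mathcomp Require Import all_boot all_order all_algebra.
From mathcomp Require Import boolp zify.
Set Implicit Arguments.
Unset Strict Implicit.
Unset Printing Implicit Defensive.

(** * Edges along a path, and rotation of path ends *)

Section EdgeCount.
Variable T : finType.
Implicit Types (e : {set T}) (s t : seq T) (D : seq (seq T)).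

Definition path_edge_seq s : seq {set T} :=
  [seq [set p.1; p.2] | p <- zip s (behead s)].

(** Counting occurrences turns edge-disjointness and covering into one equation: the multiplicities
    sum to the indicator of the edge set. *)
Definition ec e s : nat := count_mem e (path_edge_seq s).

Definition upath s : bool := (s != [::]) && uniq s.

(** Paths are unoriented: [s] and [rev s] stand for the same path. *)
Definition bimem s D : bool := (s \in D) || (rev s \in D).

Lemma ec_cons e x y s : ec e [:: x, y & s] = ([set x; y] == e) + ec e (y :: s).
Proof. by []. Qed.

Lemma ec1 e x : ec e [:: x] = 0.
Proof. by []. Qed.

Lemma ec2C e x y : ec e [:: x; y] = ec e [:: y; x].
Proof. by rewrite !ec_cons setUC. Qed.

Lemma ec2E e x y : ec e [:: x; y] = ([set x; y] == e).
Proof. by rewrite ec_cons ec1 addn0. Qed.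

Lemma ec_cat x0 e s t : s != [::] -> t != [::] ->
  ec e (s ++ t) = ec e s + ec e [:: last x0 s; head x0 t] + ec e t.
Proof.
case: t => // y t; case: s => // x s _ _ /=.
elim: s x => [|z s IH] x /=; first by rewrite !ec_cons !ec1; lia.
by rewrite ec_cons (IH z) (ec_cons e x z) addnA addnA.
Qed.

Lemma ec_rev e s : ec e (rev s) = ec e s.
Proof.
elim: s => // x s IH; rewrite rev_cons -cats1.
case: s IH => // y s IH; have r0 : rev (y :: s) != [::].
  by rewrite -size_eq0 size_rev.
rewrite (ec_cat x) // IH rev_cons last_rcons [head _ _]/= ec1 addn0 addnC.
by rewrite ec2C ec2E ec_cons.
Qed.

Lemma upath_rev s : upath (rev s) = upath s.
Proof. by rewrite /upath rev_uniq -!size_eq0 size_rev. Qed.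

Lemma ec_gt0 e s : 0 < ec e s ->
  exists s1 x y s2, s = s1 ++ [:: x, y & s2] /\ e = [set x; y].
Proof.
elim: s => // x [|y s] IH //; rewrite ec_cons.
case: eqP => [<- _|_]; first by exists [::], x, y, s.
rewrite add0n => /IH [s1 [z [w [s2 [-> ->]]]]].
by exists (x :: s1), z, w, s2.
Qed.

Lemma ec_mid s1 x y s2 : 0 < ec [set x; y] (s1 ++ [:: x, y & s2]).
Proof.
case: s1 => [|z s1]; first by rewrite ec_cons eqxx.
by rewrite (ec_cat x) // (ec_cons _ x y) eqxx; lia.
Qed.

(** Each of [x] and [y] has a single position, and the two factorisations order these positions
    oppositely. *)
Lemma uniq_adj_asym s1 s2 t1 t2 (x y : T) :
  uniq (s1 ++ [:: x, y & s2]) -> s1 ++ [:: x, y & s2] = t1 ++ [:: y, x & t2] ->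
  False.
Proof.
move=> u eqs; have u' := u; rewrite eqs in u'.
have ix (r1 r2 : seq T) a : uniq (r1 ++ a :: r2) -> index a (r1 ++ a :: r2) = size r1.
  rewrite uniq_catC /= mem_cat negb_or => /andP[/andP[_ nr] _].
  by rewrite index_cat (negbTE nr) /= eqxx addn0.
have e1 := ix _ _ _ u; have e3 := ix _ _ _ u'.
have u2 : uniq ((rcons s1 x) ++ y :: s2) by rewrite cat_rcons.
have u2' : uniq ((rcons t1 y) ++ x :: t2) by rewrite cat_rcons.
have e2 := ix _ _ _ u2; have e4 := ix _ _ _ u2'.
rewrite !cat_rcons !size_rcons in e2 e4; rewrite -eqs in e3 e4.
lia.
Qed.

Lemma bimem_rev s D : bimem (rev s) D = bimem s D.
Proof. by rewrite /bimem revK orbC. Qed.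

(* A weight that is invariant under reversal does not see the orientation
   in which [s] occurs in [D]. *)
Lemma bimem_split s D : bimem s D -> exists2 D0 : seq (seq T),
  (forall F : seq T -> nat, (forall t, F (rev t) = F t) ->
    \sum_(t <- D) F t = F s + \sum_(t <- D0) F t) &
  (forall t, bimem t D -> [\/ t = s, t = rev s | bimem t D0]) /\
  (forall p : pred (seq T), all p D -> all p D0).
Proof.
case/orP=> sD; [exists (rem s D) | exists (rem (rev s) D)].
- move=> F _; by rewrite (perm_big _ (perm_to_rem sD)) big_cons.
- split=> [t|p]; last by rewrite (perm_all _ (perm_to_rem sD)) /= => /andP[].
  rewrite /bimem !(perm_mem (perm_to_rem sD)) !inE -(inj_eq (can_inj (@revK T)) (rev t))
    revK.
  case: eqP => [-> | _]; first by constructor 1.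
  case: eqP => [-> | _]; first by constructor 2.
  by constructor 3.
- move=> F Frev; by rewrite (perm_big _ (perm_to_rem sD)) big_cons Frev.
- split=> [t|p]; last by rewrite (perm_all _ (perm_to_rem sD)) /= => /andP[].
  rewrite /bimem !(perm_mem (perm_to_rem sD)) !inE (inj_eq (can_inj (@revK T))).
  case: eqP => [-> | _]; first by constructor 2.
  case: eqP => [-> | _]; first by constructor 1.
  by constructor 3.
Qed.

End EdgeCount.

Lemma path_edgesE (X : sgraph) (s : seq X) :
  path_edges s = [set e in path_edge_seq s].
Proof.
rewrite /path_edges /path_edge_seq; apply/setP => e; rewrite inE.
by apply/imsetP/mapP => -[p pz ->]; exists p.
Qed.

Section Rotation.
Variables (T : finType) (x0 : T).
Implicit Types (E : {set {set T}}) (s t : seq T) (D : seq (seq T)).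

Definition decomp E D := all (@upath T) D /\ forall e, \sum_(s <- D) ec e s = (e \in E).

Definition endw v s : nat := (head x0 s == v) + (last x0 s == v).

(** A trivial path [[:: v]] counts as two ends at [v]. *)
Definition path_ends D v : nat := \sum_(s <- D) endw v s.

Lemma head_rev s : head x0 (rev s) = last x0 s.
Proof. by case/lastP: s => // s x; rewrite rev_rcons last_rcons. Qed.

Lemma last_rev s : last x0 (rev s) = head x0 s.
Proof. by rewrite -head_rev revK. Qed.

Lemma endw_rev v s : endw v (rev s) = endw v s.
Proof. by rewrite /endw head_rev last_rev addnC. Qed.

Lemma upath_bimem E D s : decomp E D -> bimem s D -> upath s.
Proof. by case=> /allP aD _ /orP[/aD|/aD]; rewrite ?upath_rev. Qed.

Lemma ec_bimem E D s e : decomp E D -> bimem s D -> 0 < ec e s -> e \in E.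
Proof.
case=> aD eD /bimem_split[D0 /(_ _ (@ec_rev T e)) eD0 _] e0.
by move: (eD e); rewrite eD0; case: (e \in E) => //; lia.
Qed.

Lemma bimem_uniq E D s t e : decomp E D -> bimem s D -> bimem t D ->
  0 < ec e s -> 0 < ec e t -> t = s \/ t = rev s.
Proof.
case=> aD eD sD tD es et.
have [D0 /(_ _ (@ec_rev T e)) eD0 [/(_ t tD) tD0 _]] := bimem_split sD.
case: tD0 => [->|->|tD0]; [by left|by right|].
have [D1 /(_ _ (@ec_rev T e)) eD1 _] := bimem_split tD0.
by move: (eD e); rewrite eD0 eD1; case: (e \in E); lia.
Qed.

(* [w] precedes [u] on a path that starts at [z]: moving the edge [uw] of that
   path to [uz] moves its end from [z] to [w]. *)
Definition rotates D u z w := exists a b,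
  bimem (rcons a w ++ u :: b) D /\ head x0 (rcons a w) = z.

(** Such a path can simply be extended to [u] by the edge [uz], which stops a chain of rotations. *)
Definition free_end D u z := exists s, [/\ bimem s D, head x0 s = z & u \notin s].

Fixpoint rot_chain D u z ws :=
  if ws is w :: ws' then rotates D u z w /\ rot_chain D u w ws' else free_end D u z.

Lemma rotates_edge E D u z w : decomp E D -> rotates D u z w -> [set u; w] \in E.
Proof.
move=> dD [a [b [abD _]]]; apply: (ec_bimem dD abD).
by rewrite setUC cat_rcons ec_mid.
Qed.

(** The edge [uw] lies on one path only, and [w] precedes [u] in just one orientation of it; so the
    starting end is determined. *)
Lemma rotates_inj E D u z z' w :
  decomp E D -> rotates D u z w -> rotates D u z' w -> z = z'.
Proof.
move=> dD [a [b [abD <-]]] [a' [b' [abD' <-]]].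
have ab0 : 0 < ec [set w; u] (rcons a w ++ u :: b) by rewrite cat_rcons ec_mid.
have ab0' : 0 < ec [set w; u] (rcons a' w ++ u :: b') by rewrite cat_rcons ec_mid.
have [eqs|eqs] := bimem_uniq dD abD abD' ab0 ab0'.
  by have := congr1 (head x0) eqs; case: (a) (a') => [|? ?] [|? ?].
have /andP[_ U] := upath_bimem dD abD'.
have : rcons a' w ++ u :: b' = rev b ++ [:: u, w & rev a].
  by rewrite eqs rev_cat rev_cons rev_rcons cat_rcons.
by rewrite cat_rcons in U *; move/(uniq_adj_asym U).
Qed.

Fact ends_shift (a b c d v w : nat) : a + w = w + b + c + d -> a + v = v + b + c + d.
Proof. lia. Qed.

(** Each rotation inserts the missing edge at [u] and releases the next one, so the missing edge
    travels along the chain until it extends a path at the free end. In total one end moves from [v]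
    to [u]. *)
Lemma rot_chain_add ws : forall E D u v, decomp E D -> [set u; v] \notin E -> u != v ->
  rot_chain D u v ws -> exists D', decomp ([set u; v] |: E) D' /\
    forall x, path_ends D' x + (x == v) = path_ends D x + (x == u).
Proof.
elim: ws => [|w ws IH] E D u v dD uvE uv /=.
  case=> s [sD hs us]; have us' := upath_bimem dD sD.
  have [D0 eD0 [_ aD0]] := bimem_split sD.
  have s0 : s != [::] by case/andP: us'.
  exists ((u :: s) :: D0); split; first split.
  - rewrite /= (aD0 _ dD.1) andbT; case/andP: us' => _ us'.
    by rewrite /upath /= us us'.
  - move=> e; rewrite big_cons -cat1s (ec_cat x0) // /= hs ec1 ec2E add0n -addnA.
    rewrite -eD0; last exact: ec_rev.
    rewrite dD.2 !inE (eq_sym e).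
    by case: eqP => [<-|//]; rewrite (negbTE uvE).
  - move=> x; rewrite /path_ends big_cons (eD0 (endw x)); last exact: endw_rev.
    rewrite /endw -[last x0 (u :: s)]/(last u s) hs /=.
    have -> : last u s = last x0 s by case: (s) s0.
    by rewrite (eq_sym v) (eq_sym u); lia.
case=> [[a [b [abD ha]]] ch].
have uwE : [set u; w] \in E by apply: (rotates_edge (D := D) (z := v)) => //; exists a, b.
have wv : w != v by apply: contraNneq uvE => <-.
have [D0 eD0 [mD0 aD0]] := bimem_split abD.
have upab := upath_bimem dD abD.
(* The part from [v] to [w] is turned around: the path now starts at [w], runs back to [v] and
   enters [u] by the new edge. *)
pose P' := rev (rcons a w) ++ u :: b.
pose E1 := [set u; v] |: E :\ [set u; w].
have r0 (c : seq T) x : rcons c x != [::] by case: c.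
have rr0 : rev (rcons a w) != [::] by rewrite rev_rcons.
have dD1 : decomp E1 (P' :: D0).
  split.
    rewrite /= (aD0 _ dD.1) andbT; move: upab.
    have pe : perm_eq P' (rcons a w ++ u :: b).
      by rewrite /P' perm_cat2r perm_sym -perm_rev.
    by rewrite /upath -!size_eq0 (perm_size pe) (perm_uniq pe).
  move=> e; rewrite big_cons /P' (ec_cat x0) // last_rev ha ec_rev /=.
  have := dD.2 e; rewrite eD0; last exact: ec_rev.
  rewrite (ec_cat x0) // last_rcons /= !ec2E !inE !(setUC _ [set u]) !(eq_sym e).
  case: (eqVneq [set u; v] e) => [<-|_].
    rewrite (negbTE uvE); case: eqP => [uwv|_]; last by lia.
    by move: uvE; rewrite -uwv uwE.
  case: (eqVneq [set u; w] e) => [<-|_]; first by rewrite uwE; lia.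
  by rewrite andTb; lia.
have bi1 s : bimem s D0 -> bimem s (P' :: D0).
  by rewrite /bimem !inE => /orP[->|->]; rewrite !orbT.
(* Later rotations survive: starting elsewhere than at [v], they use another path or the opposite
   end of this one, whose part up to [u] is unchanged. *)
have rot1 z w' : z != v -> rotates D u z w' -> rotates (P' :: D0) u z w'.
  move=> zv [a' [b' [abD' ha']]]; case: (mD0 _ abD') => eqs.
  - have hdc (c d : seq T) x : head x0 (rcons c x ++ d) = head x0 (rcons c x) by case: c.
    have := congr1 (head x0) eqs; rewrite !hdc ha ha' => vz.
    by rewrite vz eqxx in zv.
  - exists a', (rcons a w); split=> //; rewrite /bimem; apply/orP; right.
    rewrite inE; apply/orP; left; rewrite /P'.
    move: eqs; rewrite rev_cat rev_cons rev_rcons (cat_rcons u) => eqs.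
    have /andP[_ U] := upath_bimem dD abD'.
    have eqa : rcons a' w' = rev b /\ b' = w :: rev a.
      have szE (c d c' d' : seq T) : uniq (c ++ u :: d) -> c ++ u :: d = c' ++ u :: d' ->
        c = c' /\ d = d'.
        elim: c c' => [|x c IHc] [|x' c'] //=.
        - by move=> _ [].
        - move=> /andP[ud _] [ex ed]; by rewrite ed mem_cat inE eqxx orbT in ud.
        - move=> /andP[xd _] [ex ed]; by rewrite ex mem_cat inE eqxx orbT in xd.
        - by move=> /andP[_ U'] [-> /(IHc _ U')[-> ->]].
      exact: szE U eqs.
    case: eqa => -> _; by rewrite rev_cat rev_cons revK cat_rcons rev_rcons eqxx.
  - by exists a', b'; split=> //; apply: bi1.
have free1 z : free_end D u z -> free_end (P' :: D0) u z.
  case=> s [sD hs us]; exists s; split=> //; case: (mD0 _ sD) => [eqs|eqs|];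
    last exact: bi1.
    by rewrite eqs mem_cat inE eqxx orbT in us.
  by rewrite eqs mem_rev mem_cat inE eqxx orbT in us.
have chain1 zs z : z != v -> rot_chain D u z zs -> rot_chain (P' :: D0) u z zs.
  elim: zs z => [|z' zs IHz] z zv /=; first exact: free1.
  case=> rz cz; split; first exact: rot1.
  apply: IHz => //; apply: contraNneq uvE => <-; exact: (rotates_edge dD rz).
have uw : u != w.
  case/andP: upab => _; rewrite cat_uniq => /and3P[_ + _].
  by rewrite /= mem_rcons inE negb_or => /andP[/norP[]].
have uwE1 : [set u; w] \notin E1.
  rewrite !inE eqxx orbF; apply: contraNneq uvE => <-; exact: uwE.
have [D' [dD' eD']] := IH _ _ _ _ dD1 uwE1 uw (chain1 _ _ wv ch).
exists D'; split.
  have -> : [set u; v] |: E = [set u; w] |: E1; last by [].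
  by rewrite /E1 setUCA setD1K.
have lc (c d : seq T) y : last x0 (c ++ y :: d) = last y d by rewrite last_cat.
have hdc (c d : seq T) y : head x0 (rcons c y ++ d) = head x0 (rcons c y) by case: c.
move=> x; have := eD' x; rewrite /path_ends big_cons (eD0 (endw x) (endw_rev x)).
rewrite /P' /endw !lc hdc ha rev_rcons /= (eq_sym v) (eq_sym w).
exact: ends_shift.
Qed.

End Rotation.

(** * Decompositions with prescribed numbers of path ends *)

Section Ends.
Variables (T : finType) (x0 : T).
Implicit Types (E : {set {set T}}) (s t : seq T) (D : seq (seq T)).
Notation ends := (path_ends x0).

Lemma ends_gt0 D v : 0 < ends D v -> exists2 s, bimem s D & head x0 s = v.
Proof.
move=> e0; have /hasP[s sD] : has (fun s => 0 < endw x0 v s) D.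
  apply/negPn/negP; rewrite -all_predC => /allP a0.
  move: e0; rewrite /path_ends big1_seq // => s /= /a0 /=; lia.
rewrite /endw; case: (eqVneq (head x0 s) v) => [<- _|_].
  by exists s; rewrite // /bimem sD.
case: eqP => // <- _; exists (rev s); rewrite ?head_rev //.
by rewrite bimem_rev /bimem sD.
Qed.

Lemma rotates_neq E D u z w : decomp E D -> rotates x0 D u z w -> w != u.
Proof.
move=> dD [a [b [/(upath_bimem dD)/andP[_ +] _]]]; rewrite cat_uniq => /and3P[_ + _].
by rewrite /= mem_rcons inE negb_or eq_sym => /andP[/norP[]].
Qed.

(** Were no vertex reachable from [v] by rotations a free end, each would have a successor.
    Successors are distinct by [rotates_inj] and never [v], since [uv] is not in [E]; so a finite
    set would inject into itself minus [v]. *)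
Lemma rot_chain_exists E D u v : decomp E D -> [set u; v] \notin E -> u != v ->
  0 < ends D v -> (forall w, [set u; w] \in E -> 0 < ends D w) ->
  exists ws, rot_chain x0 D u v ws.
Proof.
move=> dD uvE uv v0 N0; pose R z w := `[<rotates x0 D u z w>].
pose S := [set z | connect R v z].
have [[z zS fz]|nofree] := pselect (exists2 z, z \in S & free_end x0 D u z).
  move: zS; rewrite inE => /connectP[ws]; elim: ws v {uvE uv v0 S} => [|w ws IH] v /=.
    by move=> _ eqz; exists [::]; rewrite -eqz.
  move=> /andP[/asboolP vw pws] eqz; have [ws' cws'] := IH w pws eqz.
  by exists (w :: ws').
have edge z w : R z w -> [set u; w] \in E by move/asboolP; apply: rotates_edge.
have uS z : z \in S -> z != u /\ 0 < ends D z.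
  rewrite inE => /connectP[ws]; case/lastP: ws => [_ ->|ws w]; first by rewrite eq_sym.
  rewrite rcons_path last_rcons => /andP[_ Rw] ->; split; last exact: N0 (edge _ _ Rw).
  exact: rotates_neq dD (asboolW Rw).
have next z : z \in S -> exists w, R z w.
  move=> zS; have [zu /ends_gt0[s sD hs]] := uS z zS.
  have us : u \in s by apply/negPn/negP => us; apply: nofree; exists z => //; exists s.
  case/splitPr: us sD hs => a b; case/lastP: a => [|a w] sD hs.
    by move: zu; rewrite -hs eqxx.
  exists w; apply/asboolP; exists a, b; split=> //.
  by rewrite -hs; case: (a).
pose nx z := odflt z [pick w | R z w].
have nxR z : z \in S -> R z (nx z).
  by case/next => w zw; rewrite /nx; case: pickP => [//|/(_ w)]; rewrite zw.
have nx_inj : {in S &, injective nx}.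
  move=> z z' zS zS' eqn; have := nxR z zS; rewrite eqn => /asboolP r1.
  exact: rotates_inj dD r1 (asboolW (nxR z' zS')).
have sub : nx @: S \subset S :\ v.
  apply/subsetP => _ /imsetP[z zS ->]; rewrite !inE; apply/andP; split.
    by apply: contraNneq uvE => <-; apply: edge (nxR z zS).
  by have := zS; rewrite inE => vz; apply: connect_trans vz (connect1 (nxR z zS)).
have vS : v \in S by rewrite inE connect0.
have := subset_leq_card sub; rewrite (card_in_imset nx_inj) (cardsD1 v S) vS.
by rewrite ltnn.
Qed.

Lemma add_edge E D u v : decomp E D -> [set u; v] \notin E -> u != v ->
  0 < ends D v -> (forall w, [set u; w] \in E -> 0 < ends D w) ->
  exists2 D', decomp ([set u; v] |: E) D' &
    forall x, ends D' x + (x == v) = ends D x + (x == u).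
Proof.
move=> dD uvE uv v0 N0; have [ws ch] := rot_chain_exists dD uvE uv v0 N0.
by have [D' [dD' eD']] := rot_chain_add dD uvE uv ch; exists D'.
Qed.

Definition degree E v := #|[set e in E | v \in e]|.

(* [z] is a vertex of even degree at which no path may end; without such an
   exception, the vertices of even degree carry two ends each. *)
Definition end_number E (z : option T) v : nat :=
  if z == Some v then 0 else if odd (degree E v) then 1 else 2.

Lemma degreeD1 E e v : e \in E -> degree E v = (v \in e) + degree (E :\ e) v.
Proof.
move=> eE; rewrite /degree (cardsD1 e) inE eE /=; congr (_ + _).
by apply: eq_card => a; rewrite !inE andbA.
Qed.

(* Deleting an edge changes the parity of the degrees of its two vertices. The
   edge is put back with [add_edge], which tolerates one vertex without ends. *)
Lemma end_decomposition E z : (forall e, e \in E -> #|e| = 2) ->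
  (forall x, z = Some x -> ~~ odd (degree E x)) ->
  exists2 D, decomp E D & forall v, ends D v = end_number E z v.
Proof.
have [k] := ubnP #|E|; elim: k E z => // k IH E z Ek E2 zE.
have rm x y : [set x; y] \in E -> [/\ x != y, #|E :\ [set x; y]| < k,
    (forall e, e \in E :\ [set x; y] -> #|e| = 2) &
    forall v, odd (degree (E :\ [set x;
      y]) v) = odd (degree E v) (+) ((v == x) || (v == y))].
  move=> xyE; split.
  - by apply/eqP => xy; have := E2 _ xyE; rewrite xy setUid cards1.
  - by rewrite (cardsD1 [set x; y]) xyE in Ek.
  - by move=> e /setD1P[_ /E2].
  - by move=> v; rewrite (degreeD1 v xyE) oddD !inE; case: (_ || _) => /=; case: odd.
have reE x y : [set x; y] \in E -> [set x; y] |: E :\ [set x; y] = E by apply: setD1K.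
(* Puts the deleted edge [xy] back, moving one end from [y] to [x]. Only [x] itself may lack ends,
   and [x] is not its own neighbour, so [add_edge] applies. *)
have transfer x y z' : [set x; y] \in E ->
  (forall w, z' = Some w -> ~~ odd (degree (E :\ [set x; y]) w)) ->
  z' != Some y -> (forall w, z' = Some w -> w = x) ->
  exists2 D, decomp E D & forall v, ends D v + (v == y) =
     end_number (E :\ [set x; y]) z' v + (v == x).
  move=> xyE z'E z'y z'x; have [xy lt2 E2' par] := rm _ _ xyE.
  have [D dD eD] := IH _ z' lt2 E2' z'E.
  have e0 w : z' != Some w -> 0 < ends D w.
    by move=> z'w; rewrite eD /end_number (negbTE z'w); case: odd.
  have xyN : [set x; y] \notin E :\ [set x; y] by rewrite !inE eqxx.
  have [|w xw|D' dD' eD'] := add_edge dD xyN xy; first exact: e0.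
    apply: e0; apply: contraTneq xw => /z'x ->; rewrite setUid.
    by apply/negP => /E2'; rewrite cards1.
  by rewrite reE // in dD'; exists D' => // v; rewrite eD' eD.
have none : exists2 D, decomp E D & forall v, ends D v = end_number E None v.
  have [E0|[e eE]] := set_0Vmem E.
    exists [seq [:: v] | v <- enum T]; first split.
    - by apply/allP => _ /mapP[v _ ->].
    - move=> e; rewrite E0 inE big_map big1 // => v _; exact: ec1.
    - move=> v; rewrite /path_ends big_map /end_number /degree E0.
      have -> : [set e : {set T} in set0 | v \in e] = set0.
        by apply/setP => e; rewrite !inE.
      rewrite cards0 /= big_enum /= (bigD1 v) //= /endw /= eqxx big1 // => w wv.
      by rewrite (negbTE wv).
  have /cards2P[x [y [xy eqe]]] : #|e| == 2 by rewrite E2.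
  move: eE; rewrite {e}eqe.
  wlog [xev|[xod yod]] : x y xy / ~~ odd (degree E x) \/ odd (degree E x) /\ odd (degree E
    y).
    move=> wl xyE; case xod : (odd (degree E x)); last by apply: (wl x y); rewrite ?xod;
      auto.
    case yod : (odd (degree E y)); first by apply: (wl x y); rewrite ?xod ?yod; auto.
    by apply: (wl y x); rewrite 1?eq_sym ?yod 1?setUC; auto.
  - move=> xyE; have [_ lt2 E2' par] := rm _ _ xyE.
    (* With [x] even and [y] odd, the deletion leaves one end at [x] and two at [y]; one end has to
       move to [x]. *)
    have [yod|yev] := boolP (odd (degree E y)).
      have [//|//|//|D dD eD] := transfer x y None xyE.
      exists D => // v; have := eD v; rewrite /end_number /= par.
      case: (eqVneq v x) => [->|vx]; first by rewrite (negbTE xev) (negbTE xy) /=; lia.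
      case: (eqVneq v y) => [->|vy]; first by rewrite yod /=; lia.
      by rewrite addbF; case: odd; lia.
    (* With both degrees even, the deletion leaves one end at each vertex, and the edge as a path of
       its own supplies the second. *)
    have [//|D dD eD] := IH _ None lt2 E2'.
    exists ([:: x; y] :: D); first split.
    + by rewrite /= dD.1 /upath /= inE xy.
    + move=> e; rewrite big_cons dD.2 ec2E !inE (eq_sym e).
      by case: eqP => //= <-; rewrite xyE.
    + move=> v; rewrite /path_ends big_cons -/(path_ends x0 D v) eD /end_number /= par
      /endw /=.
      rewrite (eq_sym x) (eq_sym y).
      case: (eqVneq v x) => [->|vx]; first by rewrite (negbTE xev) (negbTE xy) /=; lia.
      case: (eqVneq v y) => [->|vy]; first by rewrite (negbTE yev) /=; lia.
      by rewrite addbF; case: odd; lia.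
  - move=> xyE; have [_ lt2 E2' par] := rm _ _ xyE.
    (* With both degrees odd, [x] becomes the vertex without ends after the deletion; [y] then has
       two and gives one of them to [x]. *)
    have [w [<-]||w [<-] //|D dD eD] := transfer x y (Some x) xyE.
    + by rewrite par eqxx xod.
    + by apply: contraNneq xy => -[->].
    exists D => // v; have := eD v; rewrite /end_number /= par.
    have -> : (Some x == Some v) = (v == x) by rewrite eq_sym.
    case: (eqVneq v x) => [->|vx]; first by rewrite xod (negbTE xy) /=; lia.
    case: (eqVneq v y) => [->|vy]; first by rewrite yod /=; lia.
    by rewrite addbF; case: odd; lia.
case: z zE => // x /(_ x erefl) xev.
(* Deleting an edge [xy] at the exceptional vertex makes [x] odd, with a single end, which then
   moves to [y]. *)
have [[e]|isol] := pselect (exists2 e, e \in E & x \in e).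
  move=> eE; have /cards2P[a [b [ab eqe]]] : #|e| == 2 by rewrite E2.
  rewrite eqe => xe; have [y eqxy] : exists y, e = [set x; y].
    move: xe; rewrite !inE => /orP[]/eqP ->; first by exists b.
    by exists a; rewrite setUC.
  rewrite {}eqxy setUC in eE; have [yx lt2 E2' par] := rm _ _ eE.
  have [yod|yev] := boolP (odd (degree E y)).
    have [w [<-]||w [<-] //|D dD eD] := transfer y x (Some y) eE.
    + by rewrite par eqxx yod.
    + by apply: contraNneq yx => -[->].
    exists D => // v; have := eD v; rewrite /end_number /= par.
    have someE w : (Some w == Some v) = (v == w) by rewrite eq_sym.
rewrite !someE.
    case: (eqVneq v y) => [->|vy]; first by rewrite yod (negbTE yx) /=; lia.
    case: (eqVneq v x) => [->|vx]; first by rewrite (negbTE xev) /=; lia.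
    by rewrite addbF; case: odd; lia.
  have [//|//|//|D dD eD] := transfer y x None eE.
  exists D => // v; have := eD v; rewrite /end_number /= par.
  have someE w : (Some w == Some v) = (v == w) by rewrite eq_sym.
rewrite !someE.
  case: (eqVneq v y) => [->|vy]; first by rewrite (negbTE yev) (negbTE yx) /=; lia.
  case: (eqVneq v x) => [->|vx]; first by rewrite (negbTE xev) /=; lia.
  by rewrite addbF; case: odd; lia.
(* If [x] is isolated, its two ends belong to the trivial path [[:: x]], which is discarded. *)
have [D dD eD] := none.
have x2 : ends D x = 2 by rewrite eD /end_number /= (negbTE xev).
have [s sD hs] : exists2 s, bimem s D & head x0 s = x by apply: ends_gt0; rewrite x2.
have eqs : s = [:: x].
  have : upath s by apply: upath_bimem dD sD.
  case: s sD hs => // a [|b s] sD /= ax; first by rewrite ax.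
  case: isol; exists [set a; b]; last by rewrite ax !inE eqxx.
  by apply: ec_bimem dD sD _; rewrite ec_cons eqxx.
rewrite {s hs}eqs in sD; have [D0 eD0 [_ aD0]] := bimem_split sD.
exists D0; first split.
- exact: aD0 dD.1.
- by move=> e; rewrite -dD.2 eD0 ?ec1 //; apply: ec_rev.
- move=> v; have := eD v; rewrite /path_ends eD0; last exact: endw_rev.
  rewrite /end_number /endw /=; have -> : (Some x == Some v) = (x == v) by [].
  case: (eqVneq x v) => [<-|//]; rewrite (negbTE xev); lia.
Qed.
End Ends.

(** * Trails *)

Section Trails.
Variables (T : finType) (x0 : T).
Implicit Types (E : {set {set T}}) (s : seq T) (D t : seq (seq T)) (TT : seq (seq (seq T))).
Notation ends := (path_ends x0).

Lemma ec_mem e s v : 0 < ec e s -> v \in e -> v \in s.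
Proof.
case/ec_gt0 => s1 [x [y [s2 [-> ->]]]]; rewrite !inE mem_cat !inE.
by case/orP => ->; rewrite ?orbT.
Qed.

(* A trivial path [v] is absorbed by splitting, at [v], a path through [v]. *)
Lemma no_trivial_path E D : decomp E D -> (forall v, ends D v <= 2) ->
  (forall v, exists2 e, e \in E & v \in e) ->
  exists D', [/\ decomp E D', forall v, ends D' v = ends D v &
    all (fun s => 1 < size s) D'].
Proof.
have [k] := ubnP (count (fun s => size s <= 1) D).
elim: k D => // k IH D Dk dD D2 nis.
have [allD|] := boolP (all (fun s => 1 < size s) D); first by exists D.
rewrite -has_predC => /hasP[s sD] /=; rewrite -leqNgt => s1.
have [h eqs] : exists h, s = [:: h].
  have /andP[] : upath s by case: dD => /allP aD _; apply: aD.
  by case: (s) s1 => [//|h [|? ?]] //; exists h.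
rewrite {s s1}eqs in sD; have [e eE he] := nis h.
have p0 := perm_to_rem sD; set D0 := rem _ _ in p0.
have [s sD0 es] : exists2 s, s \in D0 & 0 < ec e s.
  apply/hasP; apply/negPn/negP; rewrite -all_predC => /allP a0.
  have := dD.2 e; rewrite eE (perm_big _ p0) big_cons ec1 big1_seq // => s /= /a0 /=; lia.
have p1 := perm_to_rem sD0; set D1 := rem _ _ in p1.
have pD : perm_eq D [:: [:: h], s & D1].
  by apply: perm_trans p0 _; rewrite perm_cons.
have := D2 h; rewrite /path_ends (perm_big _ pD) !big_cons {1}/endw /= eqxx => sends.
have us : upath s.
  by have [/allP aD _] := dD; apply: aD; rewrite (perm_mem pD) !inE eqxx orbT.
have [a [b eqs]] : exists a b, s = a ++ h :: b.
  by case/splitPr: (ec_mem es he) => a b; exists a, b.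
(* The trivial path already uses both ends allowed at [h], so [h] is an inner vertex of [s]. *)
have hs : head x0 s != h by move: sends; rewrite /endw; case: eqP => //; lia.
have ls : last x0 s != h by move: sends; rewrite /endw; case: (_ =P h) => //;
  case: eqP => //; lia.
have a0 : a != [::] by apply: contraNneq hs => a0; rewrite eqs a0.
have b0 : b != [::] by apply: contraNneq ls => b0; rewrite eqs b0 last_cat.
pose D' := [:: rcons a h, h :: b & D1].
have dD' : decomp E D'.
  split.
    have /allP aD := dD.1; rewrite /D' /=.
    move: us; rewrite eqs /upath cat_uniq /= => /andP[_ /and4P[ua hab hb ub]].
    rewrite rcons_uniq ua hb ub -size_eq0 size_rcons /= andbT.
    move: hab; rewrite negb_or => /andP[-> _] /=.
    by apply/allP => r rD1; apply: aD; rewrite (perm_mem pD) !inE rD1 !orbT.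
  move=> e'; rewrite -dD.2 (perm_big _ pD) !big_cons ec1 eqs.
  case: (b) b0 => // y b' _; rewrite -cats1 -(cat1s h (y :: b')) catA.
  have ah0 : a ++ [:: h] != [::] by case: (a).
  by rewrite (ec_cat x0 e' ah0) // last_cat /= (ec_cons _ h) ec2E; clear; lia.
have eD' v : ends D' v = ends D v.
  rewrite /path_ends (perm_big _ pD) /D' !big_cons eqs /endw last_rcons last_cat.
  by case: (a) (b) a0 b0 => [|x a'] // [|y b'] //= _ _; clear; lia.
have D'k : count (fun s => size s <= 1) D' < k.
  move: Dk; rewrite (permP pD) /D' /= !size_rcons !ltnS.
  case: (a) (b) a0 b0 => [|x a'] // [|y b'] //= _ _.
  by clear; lia.
have D'2 v : ends D' v <= 2 by rewrite eD'.
have [D'' [dD'' eD'' aD'']] := IH D' D'k dD' D'2 nis.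
exists D''; split=> // v; exact: etrans (eD'' v) (eD' v).
Qed.

Definition linked t := sorted (fun s s' => last x0 s == head x0 s') t.
Definition tstart t := head x0 (head [::] t).
Definition tend t := last x0 (last [::] t).
Definition lasts t := [seq last x0 s | s <- t].
Definition trail t := [&& t != [::], all (@upath T) t & linked t].
(** The break points with the two ends; the common end of a closed trail is already the last entry
    of [lasts t]. *)
Definition trail_vertices t :=
  if tstart t == tend t then lasts t else tstart t :: lasts t.

Definition trev t := rev [seq rev s | s <- t].

Lemma trev_start t : tstart (trev t) = tend t.
Proof. by rewrite /tstart /trev; case/lastP: t => // t s;
  rewrite map_rcons rev_rcons /= /tend last_rcons head_rev. Qed.

Lemma trevK : involutive trev.
Proof. by move=> t; rewrite /trev map_rev revK -map_comp map_id_in // => s _;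
  rewrite /= revK. Qed.

Lemma trev_end t : tend (trev t) = tstart t.
Proof. by rewrite -trev_start trevK. Qed.

Lemma trail_trev t : trail t -> trail (trev t).
Proof.
case/and3P=> t0 ut lt; apply/and3P; split.
- by rewrite -size_eq0 size_rev size_map size_eq0.
- rewrite all_rev all_map; apply: sub_all ut => s; by rewrite /= upath_rev.
- rewrite /linked rev_sorted sorted_map; apply: sub_sorted lt => s s'.
  by rewrite /relpre /= last_rev head_rev eq_sym.
Qed.

Lemma big_trev (F : seq T -> nat) t : (forall s, F (rev s) = F s) ->
  \sum_(s <- trev t) F s = \sum_(s <- t) F s.
Proof. by move=> Fr; rewrite /trev (perm_big _ (permEl (perm_rev _))) big_map;
  apply: eq_bigr. Qed.

Lemma count_heads t v : linked t -> t != [::] ->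
  count_mem v [seq head x0 s | s <- t] + (tend t == v) =
  count_mem v (lasts t) + (tstart t == v).
Proof.
case: t => // s t; rewrite /tend /tstart /linked /= => lt _.
elim: t s lt => [|s' t IH] s /=; first by rewrite !addn0 addnC.
case/andP=> /eqP ls lt; have := IH s' lt; rewrite ls; lia.
Qed.

(** Written without subtraction: twice the count in [lasts], plus the start, minus the end, is
    invariant under reversal. This keeps the invariant of [merge_trails] when a trail is turned
    around. *)
Lemma count_trev t v : trail t ->
  2 * count_mem v (lasts (trev t)) + (tstart (trev t) == v) + (tend t == v) =
  2 * count_mem v (lasts t) + (tstart t == v) + (tend (trev t) == v).
Proof.
case/and3P=> t0 _ lt; rewrite trev_start trev_end.
have -> : count_mem v (lasts (trev t)) = count_mem v [seq head x0 s | s <- t].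
  rewrite /lasts /trev map_rev count_rev -map_comp; congr count.
  by apply: eq_map => s; rewrite /= last_rev.
have := count_heads v lt t0; lia.
Qed.

Definition apart t t' := [&& tstart t != tstart t', tstart t != tend t',
  tend t != tstart t' & tend t != tend t'].

(* The invariant says that every vertex is an inner break point, counted
   twice, or an end of the trails as often as it is an end of paths in [D]. *)
Lemma merge_trails D : all (@upath T) D ->
  exists TT, [/\ all trail TT,
   forall F, (forall s, F (rev s) = F s) ->
     \sum_(t <- TT) \sum_(s <- t) F s = \sum_(s <- D) F s,
   forall p, (forall s, p (rev s) = p s) -> all p D -> all (all p) TT,
   forall v, \sum_(t <- TT) (2 * count_mem v (lasts t) + (tstart t == v)) =
     ends D v + \sum_(t <- TT) (tend t == v) &
   forall t t' R, perm_eq TT [:: t, t' & R] -> apart t t'].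
Proof.
move=> uD.
pose inv TT := [/\ all trail TT,
   forall F : seq T -> nat, (forall s, F (rev s) = F s) ->
     \sum_(t <- TT) \sum_(s <- t) F s = \sum_(s <- D) F s,
   forall p : pred (seq T), (forall s, p (rev s) = p s) -> all p D -> all (all p) TT &
   forall v, \sum_(t <- TT) (2 * count_mem v (lasts t) + (tstart t == v)) =
     ends D v + \sum_(t <- TT) (tend t == v)].
suff [TT [[i1 i2 i3 i4] ap]] : exists TT, inv TT /\
    forall t t' R, perm_eq TT [:: t, t' & R] -> apart t t' by exists TT.
have inv_perm TT TT' : perm_eq TT TT' -> inv TT -> inv TT'.
  move=> pe [i1 i2 i3 i4]; split.
  - by rewrite -(perm_all _ pe).
  - by move=> F Fr; rewrite -(perm_big _ pe) /= i2.
  - by move=> p pr pD; rewrite -(perm_all _ pe); apply: i3.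
  - by move=> v; rewrite -!(perm_big _ pe) /=.
have inv_rev t R : inv (t :: R) -> inv (trev t :: R).
  move=> [i1 i2 i3 i4]; have /andP[ti1 ti2] := i1; split.
  - by rewrite /= trail_trev.
  - by move=> F Fr; rewrite -i2 // !big_cons big_trev.
  - move=> p pr pD; have := i3 p pr pD; rewrite /= => /andP[pt ->]; rewrite andbT.
    rewrite all_rev all_map; apply: sub_all pt => s /=; by rewrite pr.
  - move=> v; have := i4 v; rewrite !big_cons; have := count_trev v ti1.
    clear; lia.
have inv_cat t t' R : tend t = tstart t' -> inv [:: t, t' & R] -> inv ((t ++ t') :: R).
  move=> tt' [i1 i2 i3 i4]; have /and3P[/and3P[t0 ut lt] /and3P[t0' ut' lt'] tR] := i1;
    split.
  - apply/andP; split; last exact: tR.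
    rewrite /trail -size_eq0 size_cat addn_eq0 !size_eq0 (negbTE t0) all_cat ut ut' /=.
    move: t0 t0' lt lt' tt'; case: (t) => // s r; case: (t') => // s' r' _ _.
    rewrite /linked /= /tend /tstart /= => lt lt' tt'.
    by rewrite cat_path lt /= lt' tt' eqxx.
  - by move=> F Fr; rewrite -i2 // !big_cons big_cat /= addnA.
  - move=> p pr pD; have := i3 p pr pD; rewrite /= => /and3P[pt pt' ->];
    by rewrite all_cat pt pt'.
  - move=> v; have := i4 v; rewrite !big_cons.
    have -> : tstart (t ++ t') = tstart t by case: (t) t0.
    have -> : tend (t ++ t') = tend t' by rewrite /tend last_cat; case: (t') t0'.
    rewrite /lasts map_cat count_cat tt'; clear; lia.
have inv0 : inv [seq [:: s] | s <- D].
  split.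
  - by rewrite all_map; apply: sub_all uD => s us; rewrite /= /trail /= us.
  - by move=> F Fr; rewrite big_map; apply: eq_bigr => s _; rewrite big_seq1.
  - by move=> p pr pD; rewrite all_map; apply: sub_all pD => s /= ->.
  - move=> v; rewrite !big_map /path_ends -big_split /=; apply: eq_bigr => s _.
    rewrite /endw /tstart /tend /=; lia.
move: inv0; move: [seq [:: s] | s <- D] => TT.
have [k] := ubnP (size TT); elim: k TT => // k IH TT TTk iTT.
have [ap|] := pselect (forall t t' R, perm_eq TT [:: t, t' & R] -> apart t t');
  first by exists TT.
(* Two trails sharing an end are concatenated, after suitable reversals, which lowers the number of
   trails. *)
move=> /existsNP[t /existsNP[t' /existsNP[R /not_implyP[pe /negP nap]]]].
have {}iTT := inv_perm _ _ pe iTT; have szR : (size R).+1 < k.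
  by have := perm_size pe; move: TTk => /= ; lia.
have step u u' : inv [:: u, u' & R] -> tend u = tstart u' -> exists TT,
    inv TT /\ forall t t' R, perm_eq TT [:: t, t' & R] -> apart t t'.
  by move=> iu uu'; apply: IH (inv_cat _ _ _ uu' iu).
have swap u u' : inv [:: u, u' & R] -> inv [:: u', u & R].
  by move=> iu; refine (inv_perm _ _ _ iu); apply/permP => p /=; rewrite addnCA.
have r1 := inv_rev _ _ iTT; have r2 := swap _ _ (inv_rev _ _ (swap _ _ iTT)).
have r12 := swap _ _ (inv_rev _ _ (swap _ _ r1)).
move: nap; rewrite /apart !negb_and !negbK => /or4P[] /eqP eqt.
- by apply: (step _ _ r1); rewrite trev_end.
- by apply: (step _ _ r12); rewrite trev_end trev_start.
- exact: (step _ _ iTT).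
- by apply: (step _ _ r2); rewrite trev_start.
Qed.

(** By [apart], [v] is an end of at most one trail. Since [v] has one or two path ends, the parity
    in the invariant of [merge_trails] leaves two cases: a single break point, possibly the closing
    point of a closed trail, or an end of one open trail. *)
Lemma trail_decomposition D : all (@upath T) D -> (forall v, 0 < ends D v <= 2) ->
  exists TT, [/\ all trail TT,
   forall e, \sum_(t <- TT) \sum_(s <- t) ec e s = \sum_(s <- D) ec e s,
   all (fun s => 1 < size s) D -> all (all (fun s => 1 < size s)) TT &
   forall v, \sum_(t <- TT) count_mem v (trail_vertices t) = 1].
Proof.
move=> uD eD; have [TT [i1 i2 i3 i4 ap]] := merge_trails uD; exists TT; split=> //.
- by move=> e; apply: i2; apply: ec_rev.
- by apply: i3 => s; rewrite size_rev.
move=> v; have := i4 v; have := eD v; move: (ends D v) => n n12.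
have tvE t : count_mem v (trail_vertices t) =
    count_mem v (lasts t) + (tstart t != tend t) * (tstart t == v).
  by rewrite /trail_vertices; case: eqP => _ /=; lia.
have [/hasP[t tT vt]|] := boolP (has (fun t => (tstart t == v) || (tend t == v)) TT).
  have pe := perm_to_rem tT; rewrite !(perm_big _ pe) !big_cons /= tvE.
  have nR t' : t' \in rem t TT -> (tstart t' == v = false) /\ (tend t' == v = false).
    move=> t'R; have pe' := perm_to_rem t'R.
    have : apart t t'.
      by apply: (ap _ _ (rem t' (rem t TT))); apply: perm_trans pe _; rewrite perm_cons.
    case/and4P => a b c d.
    by case/orP: vt a b c d => /eqP <- a b c d; split; apply: negbTE; rewrite eq_sym.
  have -> : \sum_(t' <- rem t TT) (2 * count_mem v (lasts t') + (tstart t' == v)) =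
      2 * \sum_(t' <- rem t TT) count_mem v (lasts t').
    rewrite big_distrr; apply: eq_big_seq => t' /nR[-> _]; by rewrite addn0.
  have -> : \sum_(t' <- rem t TT) (tend t' == v) = 0.
    by rewrite big1_seq // => t' /= /nR[_ ->].
  have -> : \sum_(t' <- rem t TT) count_mem v (trail_vertices t') =
      \sum_(t' <- rem t TT) count_mem v (lasts t').
    by apply: eq_big_seq => t' /nR[e1 _]; rewrite tvE e1 muln0 addn0.
  case: (tstart t =P tend t) vt => [->|se]; first by rewrite orbb => ->; rewrite /= mul0n;
    move: n12; clear; lia.
  case: (tstart t =P v) => [eqs|_] /=; last by move=> ->; lia.
  case: (tend t =P v) => [eqt|_]; first by rewrite eqs eqt in se.
  lia.
rewrite -all_predC => /allP nR.
have {}nR t' : t' \in TT -> (tstart t' == v = false) /\ (tend t' == v = false).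
  by move/nR => /=; rewrite negb_or => /andP[/negbTE -> /negbTE ->].
have -> : \sum_(t' <- TT) (2 * count_mem v (lasts t') + (tstart t' == v)) =
    2 * \sum_(t' <- TT) count_mem v (lasts t').
  rewrite big_distrr; apply: eq_big_seq => t' /nR[-> _]; by rewrite addn0.
have -> : \sum_(t' <- TT) (tend t' == v) = 0.
  by rewrite big1_seq // => t' /= /nR[_ ->].
have -> : \sum_(t' <- TT) count_mem v (trail_vertices t') =
    \sum_(t' <- TT) count_mem v (lasts t').
  by apply: eq_big_seq => t' /nR[e1 _]; rewrite tvE e1 muln0 addn0.
lia.
Qed.

End Trails.

(** * Orientation of a unicyclic graph *)

(** The rank is the distance to [r], and any out-neighbour of smaller rank serves as parent. *)
Lemma parent_function (T : finType) (e : rel T) (r : T) :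
  (forall v, connect e v r) ->
  exists p (rk : T -> nat), forall v, v != r -> e v (p v) /\ rk (p v) < rk v.
Proof.
move=> conn; pose P v n := `[< exists p, [/\ path e v p, last v p = r & size p = n] >].
have exP v : exists n, P v n.
  have /connectP[p pp rp] := conn v.
  by exists (size p); apply/asboolP; exists p.
pose rk v := ex_minn (exP v).
have next v : v != r -> exists w, e v w && (rk w < rk v).
  move=> vr; rewrite /rk; case: (ex_minnP (exP v)) => n /asboolP[p [pp lp <-]] _.
  case: p pp lp => [_ /= eqv|w p /= /andP[vw pw] lp]; first by rewrite eqv eqxx in vr.
  exists w; rewrite vw; case: ex_minnP => k _ /(_ (size p)); apply.
  by apply/asboolP; exists p.
exists (fun v => odflt v [pick w | e v w && (rk w < rk v)]), rk => v /next[w vw].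
by case: pickP => [w' /andP[]//|/(_ w)]; rewrite vw.
Qed.

(** The rank falls from child to parent, so the edge tells which of its vertices is the child. *)
Lemma parent_edge_inj (T : finType) (p : T -> T) (rk : T -> nat) v w :
  rk (p v) < rk v -> rk (p w) < rk w -> [set v; p v] = [set w; p w] -> v = w.
Proof.
move=> lv lw eqe; have : v \in [set w; p w] by rewrite -eqe !inE eqxx.
have : w \in [set v; p v] by rewrite eqe !inE eqxx.
rewrite !inE => /orP[/eqP->//|/eqP wv] /orP[/eqP->//|/eqP vw].
by move: lv lw; rewrite -wv -vw => /ltnW; rewrite leqNgt => /negP.
Qed.

Section Unicyclic.
Variable G : sgraph.
Implicit Types g h : G.

(* One edge [e] lies outside a spanning tree; root a spanning tree that avoids
   [e] at an end of [e]. *)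
Lemma unicyclic_orientation : unicyclic G -> exists (f : G -> G) (a : G),
  [/\ forall g, adj g (f g), injective (fun g => [set g; f g]) &
      forall g, exists k, iter k f g = a].
Proof.
case=> [[/card_gt0P[r _] conn] cardE].
have [p [rk pP]] := parent_function (fun v => conn v r).
pose A := [set [set v; p v] | v in [set~ r]].
have cardA : #|A| = #|G|.-1.
  rewrite card_in_imset ?cardsC1 // => v w; rewrite !inE => /pP[_ lv] /pP[_ lw].
  exact: (@parent_edge_inj _ p rk).
(* The tree has one edge fewer than [G]. *)
have [e eE eA] : exists2 e, e \in edge_set G & e \notin A.
  apply/subsetPn/negP => /subset_leq_card; rewrite cardA cardE.
  by rewrite (cardD1 r) inE add1n /= ltnn.
have /imsetP[[a b]] := eE; rewrite inE /= => ab eqe.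
pose e' := [rel x y | @adj G x y && ([set x; y] != e)].
have sym' : connect_sym e'.
  by apply: sym_connect_sym => x y; rewrite /= adj_sym setUC.
have conn_r v : connect e' v r.
  have [k] := ubnP (rk v); elim: k v => // k IH v vk.
  have [->|vr] := eqVneq v r; first exact: connect0.
  have [vp lv] := pP v vr; apply: connect_trans (IH (p v) (leq_trans lv vk)).
  apply: connect1; rewrite /= vp; apply: contraNneq eA => <-.
  by apply/imsetP; exists v; rewrite ?inE.
have conn_a v : connect e' v a.
  by apply: connect_trans (conn_r v) _; rewrite sym'.
have [p' [rk' pP']] := parent_function conn_a.
(* The extra edge leads from the root [a] to [b]; every other vertex points to its parent, hence
   towards [a]. *)
exists (fun v => if v == a then b else p' v), a; split.
- by move=> g; case: eqVneq => [->//|/pP'[/andP[]]].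
- have neq h : h != a -> [set a; b] <> [set h; p' h].
    by move=> /pP'[/andP[_ /eqP he] _] abh; apply: he; rewrite -abh eqe.
  move=> g h; case: (eqVneq g a) => [->|ga]; case: (eqVneq h a) => [->//|ha].
  + by move/(neq _ ha).
  + by move/esym/(neq _ ga).
  + by have [_ lg] := pP' g ga; have [_ lh] := pP' h ha; apply: (@parent_edge_inj _ p' rk').
- move=> g; have [k] := ubnP (rk' g); elim: k g => // k IH g gk.
  have [->|ga] := eqVneq g a; first by exists 0.
  have [_ lg] := pP' g ga; have [j jP] := IH (p' g) (leq_trans lg gk).
  by exists j.+1; rewrite iterSr (negbTE ga).
Qed.

End Unicyclic.

(** * Mates: levels with the same image under the orientation *)

Section Mates.
Variables (T : finType) (f : T -> T).

(** Greedy pairing inside the fibres of [f]: at most one element of each fibre stays unpaired. *)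
Lemma pair_up (S : seq T) : exists (prs : seq (T * T)) (fx : seq T),
  [/\ perm_eq (unzip1 prs ++ unzip2 prs ++ fx) S,
      forall p, p \in prs -> f p.1 = f p.2 & {in fx &, injective f}].
Proof.
elim: S => [|x S [prs [fx [pe pP inj]]]]; first by exists [::], [::].
have [/hasP[y yfx /eqP fy]|nh] := boolP (has (fun y => f y == f x) fx).
  exists ((x, y) :: prs), (rem y fx); split.
  - rewrite /= perm_cons (perm_trans _ pe) // perm_cat2l.
    rewrite -cat1s perm_catCA perm_cat2l /= perm_sym; exact: perm_to_rem.
  - by move=> p; rewrite inE => /orP[/eqP->|/pP].
  - by move=> u v /mem_rem ufx /mem_rem vfx; apply: inj.
exists prs, (x :: fx); split=> //.
  by rewrite -(cat1s x fx) -(cat1s x S) catA perm_catCA perm_cat2l -catA.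
move=> u v; rewrite !inE => /orP[/eqP->|uf] /orP[/eqP->|vf] // fuv.
- by case/negP: nh; apply/hasP; exists v => //; rewrite fuv.
- by case/negP: nh; apply/hasP; exists u => //; rewrite fuv.
- exact: inj.
Qed.

(** As every orbit leaves [F] on its way to [t], the map [f] has no cycle inside [F] and links its
    elements into disjoint chains; every second element of a chain, counted from its end, is
    chosen. *)
Lemma half_independent (F : {set T}) (t : T) : {in F &, injective f} ->
  t \notin F -> (forall g, exists k, iter k f g = t) ->
  exists2 X : {set T}, X \subset F & (forall g, g \in X ->
    f g \notin X) /\ #|F| <= 2 * #|X|.
Proof.
move=> + + reach; have [k] := ubnP #|F|; elim: k F => // k IH F Fk inj tF.
have [->|[g0 g0F]] := set_0Vmem F.
  by exists set0 => //; split=> [g|]; rewrite ?inE ?cards0.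
have [g gF fgF] : exists2 g, g \in F & f g \notin F.
  have [/exists_inP[g gF fg]|] := boolP [exists g in F, f g \notin F]; first by exists g.
  rewrite negb_exists_in => /forall_inP stable.
  have stab g : g \in F -> f g \in F by move/stable; rewrite negbK.
  have [j jt] := reach g0; case/negP: tF; rewrite -jt.
  by elim: j {jt} => //= j; apply: stab.
(* The chosen chain end [g] is removed together with its only possible predecessor in [F]. *)
pose F' := [set h in F | (h != g) && (f h != g)].
have sF' : F' \subset F by apply/subsetP => h; rewrite inE => /andP[].
have [X XF' [Xind Xcard]] : exists2 X : {set T}, X \subset F' &
    (forall g, g \in X -> f g \notin X) /\ #|F'| <= 2 * #|X|.
  apply: IH.
  - apply: leq_trans (_ : _ < #|F|) Fk; apply: proper_card; apply/properP; split=> //.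
    by exists g => //; rewrite !inE eqxx andbF.
  - by move=> u v /(subsetP sF') uF /(subsetP sF') vF; apply: inj.
  - by apply: contra tF => /(subsetP sF').
have XF h : h \in X -> h \in F' by apply: (subsetP XF').
have gX : g \notin X by apply/negP => /XF; rewrite !inE eqxx andbF.
exists (g |: X).
  by apply/subsetP => h; rewrite !inE => /orP[/eqP->//|/XF/(subsetP sF')].
split=> [h|].
  rewrite !inE negb_or => /orP[/eqP->|hX].
    apply/andP; split; first by apply: contraNneq fgF => ->.
    by apply: contra fgF => /XF/(subsetP sF').
  by rewrite Xind // andbT; move/XF: hX; rewrite !inE => /and3P[].
have lt : #|F| <= #|F'| + 2.
  have sub : F \subset F' :|: (g |: [set h in F | f h == g]).
    by apply/subsetP => h hF; rewrite !inE hF /=; case: (h == g) (f h == g) => [] [].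
  apply: leq_trans (subset_leq_card sub) _; apply: leq_trans (leq_card_setU _ _) _.
  rewrite leq_add2l; apply: leq_trans (leq_card_setU _ _) _; rewrite cards1 add1n ltnS.
  apply/card_le1P => h; rewrite inE => /andP[hF /eqP hg] h'; rewrite !inE.
  apply/idP/eqP => [/andP[h'F /eqP h'g]|->]; last by rewrite hF hg eqxx.
  by apply: inj => //; rewrite hg.
rewrite cardsU1 gX; move: (#|F|) (#|F'|) (#|X|) lt Xcard; clear; lia.
Qed.

(** A non-injective [f] has some [g] off its cycle that enters the cycle. Making [g] a mate of the
    cycle vertex [t] with the same image keeps [t] out of [fx]; every orbit reaches [t], so
    [half_independent] applies to [fx]. *)
Lemma half_mates (a : T) : (forall g, exists k, iter k f g = a) -> ~ injective f ->
  exists (prs : seq (T * T)) (fx : seq T) (X : {set T}),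
  [/\ perm_eq (unzip1 prs ++ unzip2 prs ++ fx) (enum T),
      forall p, p \in prs -> f p.1 = f p.2, {in fx &, injective f},
      forall g, g \in X -> g \in fx /\ f g \notin X & size fx <= 2 * #|X|].
Proof.
move=> reach ninj.
have [k0 ka] : exists k, iter k.+1 f a = a.
  by have [k kP] := reach (f a); exists k; rewrite iterSr.
pose C g := `[< exists i, iter i f a = g >].
have [g gC fgC] : exists2 g, ~~ C g & C (f g).
  have [g gC] : exists g, ~~ C g.
    have [/existsP//|] := boolP [exists g, ~~ C g].
    rewrite negb_exists => /forallP allC; case: ninj.
    have fsurj g : exists h, f h = g.
      have /negPn/asboolP[i <-] := allC g.
      by exists (iter (i + k0) f a); rewrite -iterS -addnS iterD ka.
    apply/injectiveP/(@leq_size_uniq _ (enum T)); first exact: enum_uniq.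
      by move=> g _; have [h <-] := fsurj g; apply: map_f; rewrite mem_enum.
    by rewrite size_map.
  have [k kP] := reach g; elim: k g kP gC => [|k IH] g.
    by move=> /= ->; case/asboolP; exists 0.
  rewrite iterSr => /IH {}IH gC; have [fC|/IH//] := boolP (C (f g)); by exists g.
(* The predecessor of [f g] on the cycle: [k0.+1] steps lead from [a] back to [a], so [i + k0] steps
   stop just before [iter i f a]. *)
have [t fgt tC] : exists2 t, f g = f t & C t.
  have /asboolP[i fg] := fgC; exists (iter (i + k0) f a).
    by rewrite -iterS -addnS iterD ka fg.
  by apply/asboolP; exists (i + k0).
have tg : t != g by apply: contraNneq gC => <-.
have reach_t u : exists k, iter k f u = t.
  have [k ku] := reach u; have /asboolP[i it] := tC.
  by exists (i + k); rewrite iterD ku it.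
have [prs [fx [pe pP inj]]] := pair_up (filter (fun x => x \notin [:: t; g]) (enum T)).
have pe' : perm_eq (unzip1 ((t, g) :: prs) ++ unzip2 ((t, g) :: prs) ++ fx) (enum T).
  have pe2 : perm_eq [:: t, g & filter (fun x => x \notin [:: t; g]) (enum T)] (enum T).
    apply: uniq_perm => [||x]; [|exact: enum_uniq|].
      by rewrite /= !inE !mem_filter !inE !eqxx orbT (negbTE tg) filter_uniq // enum_uniq.
    by rewrite !inE mem_filter mem_enum !inE; case: (x == t); case: (x == g).
  apply: perm_trans pe2; rewrite /= perm_cons -(cat1s g (_ ++ _)) perm_catCA /= perm_cons.
  exact: pe.
have ufx : uniq fx by have := enum_uniq T;
  rewrite -(perm_uniq pe') !cat_uniq => /and3P[_ _ /and3P[]].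
have tfx : t \notin fx.
  apply/negP => tf; have : t \in unzip1 prs ++ unzip2 prs ++ fx by rewrite !mem_cat tf
    !orbT.
  by rewrite (perm_mem pe) mem_filter !inE eqxx.
have [||X XF [Xi Xc]] := @half_independent [set x in fx] t _ _ reach_t.
- by move=> u v; rewrite !inE; apply: inj.
- by rewrite inE.
exists ((t, g) :: prs), fx, X; split=> //.
- by move=> p; rewrite inE => /orP[/eqP->|/pP].
- by move=> u uX; split; [have := subsetP XF u uX; rewrite inE | apply: Xi].
- by move: Xc; rewrite cardsE (card_uniqP ufx).
Qed.

End Mates.

(** * Path patterns in the product *)

Section Product.
Variables (G H : finType) (f : G -> G) (g0 : G) (h0 : H).
Hypotheses (f1 : forall g, f g != g) (f2 : forall g, f (f g) != g).
Implicit Types (s : seq H) (ss : seq (seq H)) (hs : seq H) (e : {set G * H}).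
Notation p0 := (g0, h0).

(** The bound is on twice the number of paths, so that a budget of m/2 paths per vertex stays an
    integer. *)
Definition packs (W : {set G * H} -> nat) (k : nat) := exists D : seq (seq (G * H)),
  [/\ all (@upath _) D, forall e, \sum_(s <- D) ec e s = W e & 2 * size D <= k].

Lemma packs_add W W' k k' : packs W k -> packs W' k' ->
  packs (fun e => W e + W' e) (k + k').
Proof.
case=> D [uD WD kD] [D' [uD' WD' kD']]; exists (D ++ D'); split.
- by rewrite all_cat uD.
- by move=> e; rewrite big_cat /= WD WD'.
- by rewrite size_cat mulnDr leq_add.
Qed.

Lemma packs_sub W W' k k' : W =1 W' -> k <= k' -> packs W k -> packs W' k'.
Proof.
by move=> WW kk [D [uD WD kD]]; exists D; split=> // [e|];
  [rewrite WD WW|exact: leq_trans kk].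
Qed.

Definition at_level g s : seq (G * H) := [seq (g, h) | h <- s].
Definition rung g h : seq (G * H) := [:: (g, h); (f g, h)].

Definition block_weight ss hs e :=
  \sum_(s <- ss) \sum_g ec e (at_level g s) + \sum_(h <- hs) \sum_g ec e (rung g h).

(** The budget depends on the columns [hs] only; the copies of the paths in [ss] must be covered
    within it. *)
Definition block ss hs := packs (block_weight ss hs) (#|G| * size hs).

Lemma block_cat ss ss' hs hs' : block ss hs -> block ss' hs' ->
  block (ss ++ ss') (hs ++ hs').
Proof.
move=> b b'; apply: packs_sub (packs_add b b') => [e|].
  by rewrite /block_weight !big_cat /= addnACA.
by rewrite size_cat mulnDr.
Qed.

Lemma block_perm ss ss' hs hs' : perm_eq ss ss' -> perm_eq hs hs' ->
  block ss hs -> block ss' hs'.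
Proof.
move=> ps ph; rewrite /block (perm_size ph); apply: packs_sub => // e.
by rewrite /block_weight (perm_big _ ps) (perm_big _ ph).
Qed.

Lemma block_nil : block [::] [::].
Proof. by exists [::]; split=> // e; rewrite /block_weight !big_nil. Qed.

Lemma ec_lift1 e g h : ec e (at_level g [:: h]) = 0.
Proof. by []. Qed.

(** One-vertex paths have no edges, so they may pad a trail to the length that a pattern
    requires. *)
Lemma block_trivial h ss hs : block ([:: h] :: ss) hs <-> block ss hs.
Proof.
rewrite /block; suff E : block_weight ([:: h] :: ss) hs =1 block_weight ss hs.
  by split; apply: packs_sub.
by move=> e; rewrite /block_weight big_cons big1 // => g _; rewrite ec_lift1.
Qed.

Lemma mem_lift x g s : (x \in at_level g s) = (x.1 == g) && (x.2 \in s).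
Proof.
case: x => a h /=; apply/mapP/andP => [[y ys [-> ->]]|[/eqP-> hs]]; last by exists h.
by rewrite eqxx.
Qed.

Lemma upath_lift g s : upath (at_level g s) = upath s.
Proof. by rewrite /upath -!size_eq0 size_map map_inj_uniq // => x y []. Qed.

Lemma head_lift g s : s != [::] -> head p0 (at_level g s) = (g, head h0 s).
Proof. by case: s. Qed.

Lemma last_lift g s : s != [::] -> last p0 (at_level g s) = (g, last h0 s).
Proof. by case: s => //= x s _; rewrite (last_map (pair g)). Qed.

Lemma lift_neq0 g s : (at_level g s != [::]) = (s != [::]).
Proof. by rewrite -!size_eq0 size_map. Qed.

Definition unit_weight s e g := ec e (at_level g s) + ec e (rung g (last h0 s)).

Lemma block_weight_lasts ss e :
  block_weight ss (lasts h0 ss) e = \sum_(s <- ss) \sum_g unit_weight s e g.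
Proof.
rewrite /block_weight /lasts big_map -big_split; apply: eq_bigr => s _.
by rewrite -big_split.
Qed.

(* In the layer of [s], the path [at_level v s] is continued by the column edge at
   [last s]; two such paths are joined in their common head when their levels
   are mates. For [g] in [Xp], the corresponding path of the layer of [s']
   precedes the one at level [f g]; the levels in [Xc] are left out. *)
Lemma layer (prs : seq (G * G)) (fx : seq G) (Xp Xc : {set G}) s' s :
  perm_eq (unzip1 prs ++ unzip2 prs ++ fx) (enum G) ->
  (forall p, p \in prs -> f p.1 = f p.2) -> {in fx &, injective f} ->
  {subset Xp <= fx} -> {subset Xc <= fx} -> (forall g, g \in Xp -> f g \notin Xc) ->
  upath s' -> upath s -> last h0 s' = head h0 s ->
  packs (fun e => \sum_(v | v \notin Xc) unit_weight s e v +
                  \sum_(g in Xp) unit_weight s' e g)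
        (2 * (size prs + (size fx - #|Xc|))).
Proof.
move=> pe fprs fxi Xpf Xcf XpXc us' us ls'.
have s0 : s != [::] by case/andP: us.
have s0' : s' != [::] by case/andP: us'.
(* At most one [g] in [Xp] satisfies [f g = v], because [f] is injective on [fx], so the choice made
   by [pick] misses nothing. *)
pose a v := if [pick g in Xp | f g == v] is Some g then at_level g s' ++ at_level v s else
  at_level v s.
have a_lvl v x : x \in a v -> x.1 = v \/ f x.1 = v.
  rewrite /a; case: pickP => [g /andP[_ /eqP fg]|_]; rewrite ?mem_cat !mem_lift.
    by case/orP => /andP[/eqP -> _]; [right|left].
  by case/andP => /eqP -> _; left.
have ua v : upath (a v).
  rewrite /a; case: pickP => [g /andP[_ /eqP fg]|_]; last by rewrite upath_lift.
  move: (us) (us'); rewrite -(upath_lift v s) -(upath_lift g s') /upath.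
  case/andP=> _ uv /andP[ne ug]; rewrite -size_eq0 size_cat addn_eq0 size_eq0 (negbTE ne)
    /=.
  rewrite cat_uniq uv ug andbT /=; apply/hasPn => x; rewrite !mem_lift => /andP[/eqP -> _].
  by rewrite -fg (negbTE (f1 g)).
have a0 v : a v != [::] by case/andP: (ua v).
have la v : last p0 (a v) = (v, last h0 s).
  rewrite /a; case: pickP => [g _|_]; last exact: last_lift.
  by rewrite last_cat; move: (last_lift v s0); case: (s) s0.
pose w e v := ec e (a v) + ec e (rung v (last h0 s)).
have wE e v : w e v = unit_weight s e v + \sum_(g in Xp | f g == v) unit_weight s' e g.
  rewrite /w /a; case: pickP => [g /andP[gX /eqP fg]|noX]; last first.
    by rewrite big_pred0 // addn0.
  rewrite (big_pred1 g) => [|g']; last first.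
    apply/andP/eqP => [[gX' /eqP fg']|->]; last by rewrite fg.
    by apply: fxi; [exact: Xpf|exact: Xpf|rewrite fg].
  rewrite (ec_cat p0) ?lift_neq0 // last_lift // head_lift // -ls' -fg /unit_weight /rung.
  by rewrite -(addnA (_ + _)) addnC.
pose fx' := [seq v <- fx | v \notin Xc].
exists ([seq a p.1 ++ (f p.1, last h0 s) :: rev (a p.2) | p <- prs] ++
        [seq rcons (a v) (f v, last h0 s) | v <- fx']).
have uall : uniq (unzip1 prs ++ unzip2 prs ++ fx) by rewrite (perm_uniq pe) enum_uniq.
have [dis1 dis2] : (forall p, p \in prs -> p.1 != p.2) /\
    (forall p, p \in prs -> p.1 \notin fx /\ p.2 \notin fx).
  move: uall; rewrite !cat_uniq => /and3P[_ /hasPn d1 /and3P[_ /hasPn d2 _]].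
  have m1 p : p \in prs -> p.1 \in unzip1 prs by move=> pp; apply: map_f.
  have m2 p : p \in prs -> p.2 \in unzip2 prs by move=> pp; apply: map_f.
  split=> p pp.
    apply/eqP => p12; move: (d1 p.2); rewrite mem_cat m2 // => /(_ isT).
    by rewrite /= -p12 m1.
  split; apply/negP => pf.
    by move: (d1 p.1); rewrite mem_cat pf orbT => /(_ isT); rewrite /= m1.
  by move: (d2 p.2 pf); rewrite /= m2.
(* The path [a u] meets only the level [u] and levels that [f] sends to [u]; [f1] and [f2] keep
   level [f u] apart from them. *)
have topN v u : f v = f u -> (f v, last h0 s) \notin a u.
  move=> fvu; apply/negP => /a_lvl[] /= /eqP; first by rewrite fvu (negbTE (f1 u)).
  by rewrite fvu (negbTE (f2 u)).
split.
- rewrite all_cat; apply/andP; split; apply/allP => _ /mapP[p pp ->].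
    have fp := fprs p pp.
    rewrite /upath -size_eq0 size_cat addn_eq0 size_eq0 (negbTE (a0 _)) /=.
    have /andP[_ u1] := ua p.1; have /andP[_ u2] := ua p.2.
    rewrite cat_uniq u1 /= negb_or mem_rev rev_uniq u2 !topN //= andbT.
    rewrite has_rev; apply/hasPn => x x2; apply/negP => x1.
    have p12 := dis1 p pp.
    case: (a_lvl _ _ x1) (a_lvl _ _ x2) => [e1|e1] [e2|e2].
    + by rewrite -e1 -e2 eqxx in p12.
    + by have := f1 p.2; rewrite -fp -e1 e2 eqxx.
    + by have := f1 p.1; rewrite fp -e2 e1 eqxx.
    + by rewrite -e1 -e2 eqxx in p12.
  have /andP[_ u1] := ua p.
  by rewrite /upath -size_eq0 size_rcons rcons_uniq u1 topN.
- move=> e; rewrite big_cat /= !big_map.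
  have -> : \sum_(p <- prs) ec e (a p.1 ++ (f p.1, last h0 s) :: rev (a p.2)) =
      \sum_(p <- prs) (w e p.1 + w e p.2).
    apply: eq_big_seq => p pp; have fp := fprs p pp.
    have r0 : rev (a p.2) != [::] by rewrite -size_eq0 size_rev size_eq0.
    rewrite (ec_cat p0) // la /= -(cat1s _ (rev (a p.2))) (ec_cat p0) // ec1 add0n.
    by rewrite head_rev la ec_rev /w /rung (ec2C _ (p.2, _)) fp [X in _ + X]addnC.
  have -> : \sum_(v <- fx') ec e (rcons (a v) (f v, last h0 s)) = \sum_(v <- fx') w e v.
    by apply: eq_bigr => v _; rewrite -cats1 (ec_cat p0) // la /= ec1 addn0.
  have -> : \sum_(p <- prs) (w e p.1 + w e p.2) + \sum_(v <- fx') w e v =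
      \sum_(v | v \notin Xc) w e v.
    have pe' : perm_eq (unzip1 prs ++ unzip2 prs ++ fx) (index_enum G).
      apply: perm_trans pe _; apply: uniq_perm; rewrite ?enum_uniq ?index_enum_uniq // => v.
      by rewrite mem_enum mem_index_enum.
    rewrite -(perm_big _ pe') /= !big_cat /= !big_map big_split /= -addnA.
    rewrite big_filter; congr (_ + (_ + _)).
      by rewrite [RHS]big_mkcond; apply: eq_big_seq => p /dis2[pf _];
        rewrite (contra (@Xcf _) pf).
    by rewrite [RHS]big_mkcond; apply: eq_big_seq => p /dis2[_ pf];
      rewrite (contra (@Xcf _) pf).
  rewrite (eq_bigr _ (fun v _ => wE e v)) big_split /=; congr (_ + _).
  by rewrite [RHS](partition_big f (fun v => v \notin Xc)).
- rewrite size_cat !size_map size_filter leq_mul2l leq_add2l /=.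
  rewrite -(count_predC (fun v => v \in Xc) fx).
  have -> : count (fun v => v \in Xc) fx = #|Xc|.
    have ufx : uniq fx by move: uall; rewrite !cat_uniq => /and3P[_ _ /and3P[]].
    rewrite -size_filter -(card_uniqP (filter_uniq _ ufx)); apply: eq_card => v.
    by rewrite mem_filter; case: (boolP (v \in Xc)) => // /Xcf ->.
  by rewrite addKn.
Qed.

Lemma mates_size (prs : seq (G * G)) (fx : seq G) :
  perm_eq (unzip1 prs ++ unzip2 prs ++ fx) (enum G) ->
  #|G| = size prs + size prs + size fx.
Proof. by move/perm_size; rewrite cardE => <-; rewrite !size_cat !size_map addnA. Qed.

Lemma mates_uniq (prs : seq (G * G)) (fx : seq G) :
  perm_eq (unzip1 prs ++ unzip2 prs ++ fx) (enum G) -> uniq fx.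
Proof.
by move/perm_uniq; rewrite enum_uniq !cat_uniq => /and3P[_ _ /and3P[]].
Qed.

(** The layer of [s] covers the mated levels only, and its unmated levels are absorbed by the layer
    of [s']. With p pairs and q unmated levels this takes p + (p + q) paths, and 2p + q is the order
    of [G]. *)
Lemma block_pair s s' : upath s -> upath s' -> last h0 s = head h0 s' ->
  block [:: s; s'] [:: last h0 s; last h0 s'].
Proof.
move=> us us' ss'; have [prs [fx [pe fprs fxi]]] := pair_up f (enum G).
pose F := [set x in fx].
have cF : #|F| = size fx by rewrite cardsE; apply/card_uniqP: (mates_uniq pe).
have hs : upath [:: head h0 s] by [].
have F0 : {subset set0 <= fx} by move=> x; rewrite inE.
have FF : {subset F <= fx} by move=> x; rewrite inE.
have d0 g : g \in set0 -> f g \notin F by rewrite inE.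
have d1 g : g \in F -> f g \notin set0 by move=> _; rewrite inE.
have l1 := layer pe fprs fxi F0 FF d0 hs us erefl.
have l2 := layer pe fprs fxi FF F0 d1 us us' ss'.
apply: packs_sub (packs_add l1 l2) => [e|].
  have := block_weight_lasts [:: s; s'] e; rewrite /lasts /= => ->.
  rewrite !big_cons big_nil addn0 big_set0 addn0 addnC -addnA addnC.
  congr (_ + _); last by apply: eq_bigl => v; rewrite inE.
  by rewrite [RHS](bigID (fun v => v \in F)).
rewrite (mates_size pe) cF cards0 /=; clear; lia.
Qed.

(** Every layer leaves the levels of [X] to the next one, cyclically. As [X] contains at least half
    of the unmated levels, each layer takes at most m/2 paths. *)
Lemma block_ring (a : G) t : (forall g, exists k, iter k f g = a) -> ~ injective f ->
  trail h0 t -> tstart h0 t = tend h0 t -> block t (lasts h0 t).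
Proof.
move=> reach ninj /and3P[t0 ut lt] clt.
have [prs [fx [X [pe fprs fxi Xfx Xc]]]] := half_mates reach ninj.
have aux t' s' : path (fun s s' => last h0 s == head h0 s') s' t' -> upath s' ->
    all (@upath _) t' ->
    packs (fun e => \sum_(s <- t') \sum_(v | v \notin X) unit_weight s e v +
      \sum_(s <- belast s' t') \sum_(g in X) unit_weight s e g) (#|G| * size t').
  elim: t' s' => [|s t' IH] s' /=.
    by exists [::]; split=> // e; rewrite !big_nil.
  case/andP=> /eqP s's pt us' /andP[us ut'].
  have XS : {subset X <= fx} by move=> g /Xfx[].
  have l := layer pe fprs fxi XS XS (fun g gX => (Xfx g gX).2) us' us s's.
  apply: packs_sub (packs_add l (IH s pt us ut')) => [e|].
    by rewrite !big_cons addnACA.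
  move: Xc; rewrite (mates_size pe) mulnS; move: (size prs) (size fx) #|X| (_ * size t').
  by clear; lia.
case: t t0 ut lt clt => // s t _ /= /andP[us ut] lt.
rewrite /tstart /tend /= => clt.
have ul : upath (last s t) by move: (mem_last s t);
  rewrite inE => /orP[/eqP->//|/(allP ut)].
have := aux (s :: t) (last s t); rewrite /= us ut -clt eqxx lt /= => /(_ isT ul isT).
apply: packs_sub => [e|]; last by rewrite /= /lasts size_map.
rewrite block_weight_lasts.
have pb : perm_eq (last s t :: belast s t) (s :: t).
  by rewrite (lastI s t) perm_sym perm_rcons.
rewrite (perm_big _ pb) /= -big_split /=; apply: eq_bigr => r _.
by rewrite [RHS](bigID (fun v => v \in X)) addnC.
Qed.

Lemma disjoint_lifts g g' s s' : g != g' -> ~~ has (mem (at_level g s)) (at_level g' s').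
Proof.
move=> gg; apply/hasPn => x; rewrite mem_lift => /andP[/eqP xg _] /=.
by rewrite mem_lift xg eq_sym (negbTE gg).
Qed.

Let f1' g : g != f g. Proof. by rewrite eq_sym. Qed.
Let f2' g : g != f (f g). Proof. by rewrite eq_sym. Qed.

Lemma sum_shift (F : G -> nat) : injective f -> \sum_g F (f g) = \sum_g F g.
Proof. by move=> finj; rewrite [RHS](reindex_inj finj). Qed.

Lemma sum_shift2 (F : G -> nat) : injective f -> \sum_g F (f (f g)) = \sum_g F g.
Proof. by move=> finj; rewrite -(sum_shift F) // -(sum_shift (fun g => F (f g))). Qed.

Lemma sum_shift3 (F : G -> nat) : injective f -> \sum_g F (f (f (f g))) = \sum_g F g.
Proof. by move=> finj; rewrite -(sum_shift2 F) // -(sum_shift (fun g => F (f (f g)))). Qed.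

Let head_cat (s t : seq (G * H)) : s != [::] -> head p0 (s ++ t) = head p0 s.
Proof. by case: s. Qed.

(** One path from each level climbs through four successive levels; as [f] is a permutation, the
    translates use every copy and column edge once. The first and fourth level may coincide, hence
    the last hypothesis. This takes m paths, while three columns allow 3m/2. *)
Lemma orbit4 S0 S1 S2 S3 : injective f ->
  upath S0 -> upath S1 -> upath S2 -> upath S3 ->
  last h0 S0 = head h0 S1 -> last h0 S1 = head h0 S2 -> last h0 S2 = head h0 S3 ->
  (forall g, f (f (f g)) != g) \/ (forall h, h \in S0 -> h \notin S3) ->
  block [:: S0; S1; S2; S3] [:: last h0 S0; last h0 S1; last h0 S2].
Proof.
move=> finj u0 u1 u2 u3 l0 l1 l2 dis.
have n0 : S0 != [::] by case/andP: u0. have n1 : S1 != [::] by case/andP: u1.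
have n2 : S2 != [::] by case/andP: u2. have n3 : S3 != [::] by case/andP: u3.
pose P g := at_level g S0 ++ at_level (f g) S1 ++ at_level (f (f g)) S2 ++ at_level (f (f
  (f g))) S3.
exists [seq P g | g <- enum G]; split.
- apply/allP => _ /mapP[g _ ->]; rewrite /upath -size_eq0 size_cat addn_eq0 size_eq0.
  move: u0 u1 u2 u3; rewrite -(upath_lift g S0) -(upath_lift (f g) S1).
  rewrite -(upath_lift (f (f g)) S2) -(upath_lift (f (f (f g))) S3).
  move=> /andP[/negbTE e0 v0] /andP[_ v1] /andP[_ v2] /andP[_ v3].
  rewrite e0 /= !cat_uniq v0 v1 v2 v3 !has_cat !negb_or /= !andbT.
  rewrite !(disjoint_lifts _ _ (f1' _)) !(disjoint_lifts _ _ (f2' _)) /= andbT.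
  case: dis => [f3|dis]; first by rewrite disjoint_lifts // eq_sym.
  apply/hasPn => x; rewrite mem_lift => /andP[_ x3] /=; apply/negP; rewrite mem_lift.
  by move=> /andP[_ /dis]; rewrite x3.
- move=> e; rewrite big_map big_enum /= /block_weight !big_cons !big_nil !addn0.
  have PE g : ec e (P g) =
      (ec e (at_level g S0) + ec e (rung g (last h0 S0))) +
      ((ec e (at_level (f g) S1) + ec e (rung (f g) (last h0 S1))) +
       ((ec e (at_level (f (f g)) S2) + ec e (rung (f (f g)) (last h0 S2))) +
        ec e (at_level (f (f (f g))) S3))).
    rewrite /P !(ec_cat p0) -?size_eq0 ?size_cat ?addn_eq0 ?size_eq0 ?negb_and ?lift_neq0
      ?n0 ?n1 ?n2 ?n3 //.
    by rewrite !head_cat ?lift_neq0 // !last_lift // !head_lift // -l0 -l1 -l2.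
  have split (a b c d x y z : G -> nat) :
      \sum_g (a g + x g + (b g + y g + (c g + z g + d g))) =
      \sum_g a g + \sum_g x g + (\sum_g b g + \sum_g y g +
        (\sum_g c g + \sum_g z g + \sum_g d g)) by rewrite !big_split.
  rewrite (eq_bigr _ (fun g _ => PE g)) (split (fun g => ec e (at_level g S0))
    (fun g => ec e (at_level (f g) S1)) (fun g => ec e (at_level (f (f g)) S2))
    (fun g => ec e (at_level (f (f (f g))) S3)) (fun g => ec e (rung g (last h0 S0)))
    (fun g => ec e (rung (f g) (last h0 S1))) (fun g => ec e (rung (f (f g)) (last h0
      S2)))).
  rewrite (sum_shift (fun g => ec e (at_level g S1))) // (sum_shift2 (fun g => ec e
    (at_level g S2))) //.
  rewrite (sum_shift3 (fun g => ec e (at_level g S3))) //.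
  rewrite (sum_shift (fun g => ec e (rung g (last h0 S1)))) //.
  rewrite (sum_shift2 (fun g => ec e (rung g (last h0 S2)))) //.
  move: (\sum_g ec e (at_level g S0)) (\sum_g ec e (at_level g S1)) (\sum_g ec e (at_level
    g S2)).
  move: (\sum_g ec e (at_level g S3)) (\sum_g _) (\sum_g _) (\sum_g _).
  by clear; lia.
- by rewrite size_map -cardE mulnC leq_mul2l orbT.
Qed.

(** The same climb through three levels, which are always distinct; its m paths are exactly the
    budget of two columns. *)
Lemma orbit3 S0 S1 S2 : injective f -> upath S0 -> upath S1 -> upath S2 ->
  last h0 S0 = head h0 S1 -> last h0 S1 = head h0 S2 ->
  block [:: S0; S1; S2] [:: last h0 S0; last h0 S1].
Proof.
move=> finj u0 u1 u2 l0 l1.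
have n0 : S0 != [::] by case/andP: u0. have n1 : S1 != [::] by case/andP: u1.
have n2 : S2 != [::] by case/andP: u2.
pose P g := at_level g S0 ++ at_level (f g) S1 ++ at_level (f (f g)) S2.
exists [seq P g | g <- enum G]; split.
- apply/allP => _ /mapP[g _ ->]; rewrite /upath -size_eq0 size_cat addn_eq0 size_eq0.
  move: u0 u1 u2; rewrite -(upath_lift g S0) -(upath_lift (f g) S1).
  rewrite -(upath_lift (f (f g)) S2).
  move=> /andP[/negbTE e0 v0] /andP[_ v1] /andP[_ v2].
  rewrite e0 /= !cat_uniq v0 v1 v2 !has_cat !negb_or /= !andbT.
  by rewrite !(disjoint_lifts _ _ (f1' _)) !(disjoint_lifts _ _ (f2' _)).
- move=> e; rewrite big_map big_enum /= /block_weight !big_cons !big_nil !addn0.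
  have PE g : ec e (P g) =
      (ec e (at_level g S0) + ec e (rung g (last h0 S0))) +
      ((ec e (at_level (f g) S1) + ec e (rung (f g) (last h0 S1))) +
        ec e (at_level (f (f g)) S2)).
    rewrite /P !(ec_cat p0) -?size_eq0 ?size_cat ?addn_eq0 ?size_eq0 ?negb_and ?lift_neq0
      ?n0 ?n1 ?n2 //.
    by rewrite !head_cat ?lift_neq0 // !last_lift // !head_lift // -l0 -l1.
  have split (a b c x y : G -> nat) :
      \sum_g (a g + x g + (b g + y g + c g)) =
      \sum_g a g + \sum_g x g + (\sum_g b g + \sum_g y g + \sum_g c g).
    by rewrite !big_split.
  rewrite (eq_bigr _ (fun g _ => PE g)) (split (fun g => ec e (at_level g S0))
    (fun g => ec e (at_level (f g) S1)) (fun g => ec e (at_level (f (f g)) S2))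
    (fun g => ec e (rung g (last h0 S0))) (fun g => ec e (rung (f g) (last h0 S1)))).
  rewrite (sum_shift (fun g => ec e (at_level g S1))) // (sum_shift2 (fun g => ec e
    (at_level g S2))) //.
  rewrite (sum_shift (fun g => ec e (rung g (last h0 S1)))) //.
  move: (\sum_g ec e (at_level g S0)) (\sum_g ec e (at_level g S1)) (\sum_g ec e (at_level
    g S2)).
  by move: (\sum_g _) (\sum_g _); clear; lia.
- by rewrite size_map -cardE mulnC leq_mul2l orbT.
Qed.

(* The cycle of levels minus one edge, and that edge. *)
Lemma block_column (a : G) h : injective f -> (forall g, exists k, iter k f g = a) ->
  3 < #|G| -> block [::] [:: h].
Proof.
move=> finj reach G4; have inO g : g \in orbit f a.
  have [k ka] := reach g; rewrite -fconnect_orbit (fconnect_sym finj) -ka.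
  exact: fconnect_iter.
have pO : perm_eq (orbit f a) (index_enum G).
  by apply: uniq_perm; rewrite ?orbit_uniq ?index_enum_uniq // => g;
    rewrite inO mem_index_enum.
have := cycle_orbit finj a; case eqO : (orbit f a) (inO a) pO => [//|b p] _ pO.
rewrite /= rcons_path => /andP[pp /eqP lp].
have uO : uniq (b :: p) by rewrite -eqO orbit_uniq.
(* Two paths count four, which fits the budget because [3 < #|G|]. *)
exists [:: [seq (g, h) | g <- b :: p]; rung (last b p) h]; split.
- apply/and3P; split=> //.
    by rewrite /upath map_inj_uniq // => x y [].
  by rewrite /upath /rung /= inE xpair_eqE eqxx andbT andbT f1'.
- move=> e; rewrite !big_cons big_nil addn0 /block_weight big_nil big_seq1 add0n.
  rewrite -(perm_big _ pO) /= {uO pO eqO lp}.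
  elim: p b pp => [|c p IH] b /=; first by rewrite big_seq1.
  case/andP=> /eqP bc pp; rewrite big_cons -(IH c pp) /= addnA; congr (_ + _).
  by rewrite ec_cons /rung bc ec2E.
- by rewrite /= muln1.
Qed.

(* The three translates of a path through the copies of [A1], [A2], [A3] and the
   three columns would be cycles, hence the asymmetry between the levels. *)
Lemma block_triangle A1 A2 A3 (a : G) : injective f -> #|G| = 3 ->
  upath A1 -> upath A2 -> upath A3 ->
  last h0 A1 = head h0 A2 -> last h0 A2 = head h0 A3 -> last h0 A3 = head h0 A1 ->
  last h0 A2 != last h0 A3 ->
  block [:: A1; A2; A3] [:: last h0 A1; last h0 A2; last h0 A3].
Proof.
move=> finj G3 u1 u2 u3 l12 l23 l31 n23.
have n1 : A1 != [::] by case/andP: u1. have n2 : A2 != [::] by case/andP: u2.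
have n3 : A3 != [::] by case/andP: u3.
pose b := f a; pose c := f b.
have ab : a != b by exact: f1'. have bc : b != c by exact: f1'.
have ac : a != c by exact: f2'.
have uabc : uniq [:: a; b; c] by rewrite /= !inE negb_or ab ac bc.
have pabc : perm_eq [:: a; b; c] (index_enum G).
  have sub : {subset [:: a; b; c] <= enum G} by move=> x _; rewrite mem_enum.
  have [|_ eqm] := uniq_min_size uabc sub; first by rewrite -cardE G3.
  apply: uniq_perm; rewrite ?index_enum_uniq // => x.
  by rewrite eqm mem_enum mem_index_enum.
have sumG (F : G -> nat) : \sum_g F g = F a + F b + F c.
  by rewrite -(perm_big _ pabc) /= !big_cons big_nil addn0 addnA.
have fc : f c = a.
  have : f c \in [:: a; b; c] by rewrite (perm_mem pabc) mem_index_enum.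
  rewrite !inE => /or3P[/eqP//|/eqP cb|/eqP cc].
    by have := f2 a; rewrite -/b -/c -(inj_eq finj) cb /b eqxx.
  by have := f1 c; rewrite cc eqxx.
pose h1 := last h0 A1; pose h2 := last h0 A2; pose h3 := last h0 A3.
(* Four paths count eight, against a budget of nine. The second meets level [a] in [h3] and [h2],
   which must therefore differ. *)
exists [:: at_level a A1 ++ at_level b A2 ++ at_level c A3;
  (a, h3) :: at_level b A1 ++ at_level c A2 ++ [:: (a, h2)];
  (b, h3) :: at_level c A1 ++ at_level a A2;
  at_level b (rev A3) ++ at_level a A3 ++ [:: (c, h3)]].
split.
- have rn : rev A3 != [::] by rewrite -size_eq0 size_rev size_eq0.
  have ud : uniq (at_level a A1) && uniq (at_level b A1) && uniq (at_level c A1) && uniq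
    (at_level a A2) &&
      uniq (at_level b A2) && uniq (at_level c A2) && uniq (at_level a A3) && uniq
        (at_level b (rev A3)) &&
      uniq (at_level c A3).
    have ul g s : upath s -> uniq (at_level g s) by rewrite -(upath_lift g) => /andP[].
    by rewrite !ul // upath_rev.
  move: ud => /andP[/andP[/andP[/andP[/andP[/andP[/andP[/andP[a1 b1] c1] a2] b2] c2] a3]
    b3] c3].
  have ba : b != a by rewrite eq_sym. have cb : c != b by rewrite eq_sym.
  have ca : c != a by rewrite eq_sym.
  have dl := disjoint_lifts.
  have up x (s t : seq (G * H)) : uniq (x :: s ++ t) -> upath (x :: s ++ t) by [].
  have up' (s t : seq (G * H)) : s != [::] -> uniq (s ++ t) -> upath (s ++ t) by case: s.
  have l1 g h : at_level g [:: h] = [:: (g, h)] by [].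
  rewrite /= !andbT; apply/and4P; split.
  + apply: up'; first by rewrite lift_neq0.
    by rewrite !cat_uniq !has_cat !negb_or a1 b2 c3 !dl.
  + apply: up.
    have -> : (a, h3) :: at_level b A1 ++ at_level c A2 ++ [:: (a, h2)] =
        at_level a [:: h3] ++ at_level b A1 ++ at_level c A2 ++ at_level a [:: h2] by [].
    rewrite !cat_uniq !has_cat !negb_or b1 c2 !dl //= !andbT.
    by rewrite xpair_eqE eqxx n23 !mem_lift (negbTE ab) (negbTE ac).
  + apply: up; have -> : (b, h3) :: at_level c A1 ++ at_level a A2 =
        at_level b [:: h3] ++ at_level c A1 ++ at_level a A2 by [].
    by rewrite !cat_uniq !has_cat !negb_or c1 a2 !dl.
  + apply: up'; first by rewrite lift_neq0.
    rewrite -l1 !cat_uniq !has_cat !negb_or b3 a3 !dl // /= ?mem_lift /=.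
    by rewrite (negbTE cb) (negbTE ca).
- move=> e; rewrite !big_cons !big_nil !addn0 /block_weight !big_cons !big_nil !addn0 !sumG.
  have e1 : ec e (at_level a A1 ++ at_level b A2 ++ at_level c A3) = ec e (at_level a A1) +
    ec e (rung a h1) +
      (ec e (at_level b A2) + ec e (rung b h2) + ec e (at_level c A3)).
    rewrite !(ec_cat p0) -?size_eq0 ?size_cat ?addn_eq0 ?size_eq0 ?negb_and ?lift_neq0 ?n1
      ?n2 ?n3 //.
    by rewrite !head_cat ?lift_neq0 // !last_lift // !head_lift // -l12 -l23.
  have e2 : ec e ((a, h3) :: at_level b A1 ++ at_level c A2 ++ [:: (a, h2)]) =
      ec e (rung a h3) + (ec e (at_level b A1) + ec e (rung b h1) + (ec e (at_level c A2) +
        ec e (rung c h2))).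
    rewrite -cat1s !(ec_cat p0) -?size_eq0 ?size_cat ?addn_eq0 ?size_eq0 ?negb_and
      ?lift_neq0 ?n1 ?n2 ?n3 //.
    rewrite !ec1 !head_cat ?lift_neq0 // !last_lift // !head_lift // -l12 -l31 /rung fc.
    by rewrite add0n addn0.
  have e3 : ec e ((b, h3) :: at_level c A1 ++ at_level a A2) =
      ec e (rung b h3) + (ec e (at_level c A1) + ec e (rung c h1) + ec e (at_level a A2)).
    rewrite -cat1s !(ec_cat p0) -?size_eq0 ?size_cat ?addn_eq0 ?size_eq0 ?negb_and
      ?lift_neq0 ?n1 ?n2 ?n3 //.
    rewrite !ec1 !head_cat ?lift_neq0 // !last_lift // !head_lift // -l12 -l31 /rung fc.
    by rewrite add0n.
  have e4 : ec e (at_level b (rev A3) ++ at_level a A3 ++ [:: (c, h3)]) =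
      ec e (at_level b A3) + ec e (rung a h2) + (ec e (at_level a A3) + ec e (rung c h3)).
    have rn : rev A3 != [::] by rewrite -size_eq0 size_rev size_eq0.
    rewrite !(ec_cat p0) -?size_eq0 ?size_cat ?addn_eq0 ?size_eq0 ?negb_and ?lift_neq0 ?rn
      ?n3 //.
    rewrite !ec1 !head_cat ?lift_neq0 // !last_lift // !head_lift // last_rev -l23 /rung fc.
    by rewrite addn0 (ec2C _ (b, _)) (ec2C _ (a, last h0 A3)) /at_level map_rev ec_rev.
  rewrite e1 e2 e3 e4 -/h1 -/h2 -/h3.
  move: (ec e (rung a h1)) (ec e (rung b h1)) (ec e (rung c h1)) => x1 x2 x3.
  move: (ec e (rung a h2)) (ec e (rung b h2)) (ec e (rung c h2)) => y1 y2 y3.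
  move: (ec e (rung a h3)) (ec e (rung b h3)) (ec e (rung c h3)) => z1 z2 z3.
  move: (ec e (at_level a A1)) (ec e (at_level b A1)) (ec e (at_level c A1)) => u1' u2' u3'.
  move: (ec e (at_level a A2)) (ec e (at_level b A2)) (ec e (at_level c A2)) => v1 v2 v3.
  move: (ec e (at_level a A3)) (ec e (at_level b A3)) (ec e (at_level c A3)) => w1 w2 w3.
  by clear; lia.
- by rewrite G3.
Qed.

End Product.

(** * Decomposing the blocks of single trails *)

Section TrailBlocks.
Variables (G H : finType) (f : G -> G) (a : G) (h0 : H).
Hypotheses (f1 : forall g, f g != g) (f2 : forall g, f (f g) != g).
Hypothesis reach : forall g, exists k, iter k f g = a.
Implicit Types (s : seq H) (t : seq (seq H)).
Notation block := (@block G H f).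
Notation lasts := (lasts h0).

Lemma block_pairs t : all (@upath H) t -> linked h0 t -> ~~ odd (size t) ->
  block t (lasts t).
Proof.
have [k] := ubnP (size t); elim: k t => // k IH [|s [|s' t]] //=.
  by move=> _ _ _ _; apply: block_nil.
move=> tk /and3P[us us' ut] /andP[/eqP ss' lt] ev.
have lt' : linked h0 t by apply: path_sorted lt.
have b := block_pair a f1 f2 us us' ss'.
apply: (block_cat b (IH t _ ut lt' _)); last by rewrite negbK in ev.
by move: tk; clear; lia.
Qed.

(** The trivial path at the start contributes the start vertex as a last vertex and makes the number
    of paths even. *)
Lemma block_open t : trail h0 t -> odd (size t) -> block t (tstart h0 t :: lasts t).
Proof.
case/and3P=> t0 ut lt ot; apply/(block_trivial f (tstart h0 t)).
apply: (@block_pairs ([:: tstart h0 t] :: t)); rewrite /= ?ut ?ot //.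
by case: t t0 lt {ut ot} => // s t _; rewrite /linked /= eqxx.
Qed.

Lemma block_column_open t : (forall h, block [::] [:: h]) -> trail h0 t ->
  block t (tstart h0 t :: lasts t).
Proof.
move=> bcol tt; have [ot|et] := boolP (odd (size t)); first exact: block_open.
case/and3P: tt => _ ut lt.
exact: (block_cat (bcol (tstart h0 t)) (block_pairs ut lt et)).
Qed.

Lemma linked_cons s s' t : linked h0 (s :: s' :: t) ->
  last h0 s = head h0 s' /\ linked h0 (s' :: t).
Proof. by case/andP=> /eqP. Qed.

(** A closed trail is a ring, and a single column is the ring of a trivial path. *)
Lemma block_trail_branching t : ~ injective f -> trail h0 t ->
  block t (trail_vertices h0 t).
Proof.
move=> ninj tt; rewrite /trail_vertices; case: eqP => [clt|_].
  exact: (block_ring a f1 f2 reach ninj).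
apply: block_column_open => // h; apply/(block_trivial f h).
by apply: (block_ring (h0 := h0) a f1 f2 reach ninj (t := [:: [:: h]])).
Qed.

Lemma closed_singleton s : upath s -> head h0 s = last h0 s -> exists h, s = [:: h].
Proof.
case: s => // x [|y s]; first by exists x.
move=> /and3P[_ xs _] /= eqx; case/negP: xs; rewrite [x]eqx; exact: mem_last.
Qed.

(** An orbit of three levels would be closed under [f] and its inverse, contain [a], and hence be
    all of [G]. *)
Lemma no_3cycle : injective f -> 3 < #|G| -> forall g, f (f (f g)) != g.
Proof.
move=> finj G4 g; apply/eqP => f3; pose S := [:: g; f g; f (f g)].
have stab u : u \in S -> f u \in S.
  by rewrite !inE => /or3P[] /eqP ->; rewrite ?f3 eqxx ?orbT.
have stab' u : f u \in S -> u \in S.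
  rewrite !inE => /or3P[] /eqP e; apply/or3P.
  - by apply: Or33; rewrite -(inj_eq finj) e f3.
  - by apply: Or31; rewrite -(inj_eq finj) e.
  - by apply: Or32; rewrite -(inj_eq finj) e.
have aS : a \in S.
  have [k <-] := reach g; elim: k => [|k IH]; first by rewrite !inE eqxx.
  exact: stab.
have allS u : u \in S.
  have [k] := reach u; elim: k u => [|k IH] u; first by move=> /= ->.
  by rewrite iterSr => /IH/stab'.
have : #|G| <= size S.
  by apply: leq_trans (card_size S); apply/subset_leq_card/subsetP => u _; apply: allS.
by rewrite leqNgt G4.
Qed.

(** The first three paths, padded by a trivial fourth one, climb as in [orbit4]; an even number of
    paths is left for pairing. *)
Lemma block_closed_long s1 s2 s3 t : injective f -> 3 < #|G| ->
  all (@upath H) [:: s1, s2, s3 & t] -> linked h0 [:: s1, s2, s3 & t] -> ~~ odd (size t) ->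
  block [:: s1, s2, s3 & t] (lasts [:: s1, s2, s3 & t]).
Proof.
move=> finj G4 /and4P[u1 u2 u3 ut] /linked_cons[l12 /linked_cons[l23 l3]] et.
have lt : linked h0 t by apply: path_sorted l3.
have us : upath [:: last h0 s3] by [].
have := orbit4 a f1 f2 finj u1 u2 u3 us l12 l23 erefl (or_introl (no_3cycle finj G4)).
move=> b; have {}b : block [:: s1; s2; s3] (lasts [:: s1; s2; s3]).
  apply/(block_trivial f (last h0 s3)); apply: block_perm b => //.
  exact: permEl (perm_rcons [:: last h0 s3] [:: s1; s2; s3]).
exact: (block_cat b (block_pairs ut lt et)).
Qed.

Lemma block_trail_cycle t : injective f -> 3 < #|G| -> trail h0 t ->
  block t (trail_vertices h0 t).
Proof.
move=> finj G4 tt; have bcol h : block [::] [:: h] := block_column f1 h finj reach G4.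
rewrite /trail_vertices; case: eqP => [clt|_]; last exact: block_column_open.
have /and3P[t0 ut lt] := tt; have [ot|et] := boolP (odd (size t)); last exact: block_pairs.
case: t t0 ut lt ot clt {tt} => // s1 [|s2 [|s3 t]] // _.
  rewrite /= andbT => u1 _ _ /(closed_singleton u1)[h ->]; apply/block_trivial; exact: bcol.
move=> ut lt ot _; apply: block_closed_long => //; by move: ot; rewrite /= !negbK.
Qed.

(** Here [f] has order three, so a climb through four levels returns to its first level, and a
    single column exceeds its budget. Odd numbers of vertices are thus handled according to the
    shape of the trail. *)
Lemma block_trail_triangle t : injective f -> #|G| = 3 -> trail h0 t ->
  all (fun s => 1 < size s) t -> uniq (trail_vertices h0 t) ->
  block t (trail_vertices h0 t).
Proof.
move=> finj G3 tt; have /and3P[t0 ut lt] := tt.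
rewrite /trail_vertices; case: eqP => [clt|_] at1; last first.
  have [ot _|et] := boolP (odd (size t)); first exact: block_open.
  case: t t0 ut lt et at1 {tt} => // s1 [|s2 t] // _ /and3P[u1 u2 ut] lt et _ /= /and3P[nu
    _ _].
  have [l12 lt2] := linked_cons lt; have lt' : linked h0 t by apply: path_sorted lt2.
  have uh : upath [:: head h0 s1] by []. have ul : upath [:: last h0 s2] by [].
  (* The trivial paths at both ends of the climb share a level; they are disjoint because the
     vertices of the trail are distinct. *)
  have dis h : h \in [:: head h0 s1] -> h \notin [:: last h0 s2].
    rewrite inE => /eqP ->; rewrite inE; move: nu; rewrite /tstart /=;
      apply: contra => /eqP ->.
    by rewrite !inE eqxx orbT.
  have := orbit4 a f1 f2 finj uh u1 u2 ul erefl l12 erefl (or_intror dis).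
  move/(block_trivial f (head h0 s1)) => b.
  have {}b : block [:: s1; s2] [:: head h0 s1; last h0 s1; last h0 s2].
    apply/(block_trivial f (last h0 s2)); apply: block_perm b => //.
    exact: permEl (perm_rcons [:: last h0 s2] [:: s1; s2]).
  by apply: (block_cat b (block_pairs ut lt' _)); move: et; rewrite /= !negbK.
move=> uv; have [ot|et] := boolP (odd (size t)); last exact: block_pairs.
case: t t0 ut lt ot clt at1 uv {tt} => // s1 [|s2 [|s3 t]] // _.
  rewrite /= andbT => u1 _ _ clt; rewrite andbT.
  by have [h ->] := closed_singleton u1 clt.
move=> /and4P[u1 u2 u3 ut] lt ot clt _ uv.
have [l12 lt2] := linked_cons lt; have [l23 lt3] := linked_cons lt2.
case: t ut lt ot clt uv lt2 lt3 => [|s4 [|s5 t]] //.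
  move=> _ _ _ clt uv _ _; apply: (block_triangle a f1 f2) => //.
  by move: uv; rewrite /= !inE => /and3P[_].
move=> /and3P[u4 u5 ut] lt ot clt uv lt2 lt3.
have [l34 lt4] := linked_cons lt3; have [l45 lt5] := linked_cons lt4.
have lt' : linked h0 t by apply: path_sorted lt5.
(* From five paths on, [orbit3] takes the first two columns with three paths, and [orbit4], padded
   at both ends, takes the next three columns with two paths. *)
have b1 := orbit3 a f1 f2 finj u1 u2 u3 l12 l23.
have uh : upath [:: last h0 s3] by []. have ul : upath [:: last h0 s5] by [].
have dis h : h \in [:: last h0 s3] -> h \notin [:: last h0 s5].
  rewrite inE => /eqP ->; rewrite inE; apply: contraL uv => /eqP /= ->.
  by rewrite !inE eqxx !orbT !andbF.
have := orbit4 a f1 f2 finj uh u4 u5 ul l34 l45 erefl (or_intror dis).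
move/(block_trivial f (last h0 s3)) => b.
have {}b : block [:: s4; s5] [:: last h0 s3; last h0 s4; last h0 s5].
  apply/(block_trivial f (last h0 s5)); apply: block_perm b => //.
  exact: permEl (perm_rcons [:: last h0 s5] [:: s4; s5]).
have b2 : block t (lasts t).
  by apply: block_pairs => //; move: ot; rewrite /= !negbK.
exact: (block_cat b1 (block_cat b b2)).
Qed.

Lemma block_flatten (TT : seq (seq (seq H))) :
  (forall t, t \in TT -> block t (trail_vertices h0 t)) ->
  block (flatten TT) (flatten [seq trail_vertices h0 t | t <- TT]).
Proof.
elim: TT => [|t TT IH] bTT; first exact: block_nil.
apply: block_cat; first by apply: bTT; rewrite mem_head.
by apply: IH => u uT; apply: bTT; rewrite inE uT orbT.
Qed.

End TrailBlocks.

(** * Decompositions of the product *)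

Section Decompositions.
Variable X : sgraph.
Implicit Types (s : seq X) (D : seq (seq X)).

Lemma mem_edge_set (x y : X) : ([set x; y] \in edge_set X) = adj x y.
Proof.
apply/imsetP/idP => [[[u v]]|xy]; last by exists (x, y); rewrite ?inE.
rewrite inE /= => uv eqe.
have xe : x \in [set u; v] by rewrite -eqe !inE eqxx.
have ye : y \in [set u; v] by rewrite -eqe !inE eqxx orbT.
have vu : adj v u by rewrite adj_sym.
have nuv : u != v by apply: contraTneq uv => ->; rewrite adj_irrefl.
have nxy : x != y.
  have : #|[set x; y]| = 2 by rewrite eqe cards2 nuv.
  by rewrite cards2; case: (x != y).
by move: xe ye nxy; rewrite !inE => /orP[]/eqP -> /orP[]/eqP ->; rewrite ?eqxx.
Qed.

Lemma card_edge (e : {set X}) : e \in edge_set X -> #|e| = 2.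
Proof.
case/imsetP=> -[u v]; rewrite inE /= => uv ->.
by rewrite cards2; case: eqP uv => // ->; rewrite adj_irrefl.
Qed.

Lemma sorted_edges s : (forall e, 0 < ec e s -> e \in edge_set X) -> sorted (@adj X) s.
Proof.
case: s => // x s; elim: s x => // y s IH x eP /=.
rewrite -mem_edge_set eP ?ec_cons ?eqxx //=.
by apply: IH => e e0; apply: eP; rewrite ec_cons; apply: leq_trans e0 (leq_addl _ _).
Qed.

Lemma mem_path_edges e s : (e \in path_edges s) = (0 < ec e s).
Proof. by rewrite path_edgesE inE /ec -has_count has_pred1. Qed.

Lemma mem_bigcup_seq e D :
  (e \in \bigcup_(s <- D) path_edges s) = has (fun s => 0 < ec e s) D.
Proof.
elim: D => [|s D IH]; first by rewrite big_nil inE.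
by rewrite big_cons inE IH mem_path_edges.
Qed.

(** A multiplicity at most one separates the paths, and a positive one on each edge gives the
    covering. *)
Lemma decompositionP D : decomp (edge_set X) D -> path_decomposition D.
Proof.
case=> /allP uD eD.
have ge s e : s \in D -> ec e s <= (e \in edge_set X).
  by move=> sD; rewrite -eD (perm_big _ (perm_to_rem sD)) big_cons leq_addr.
split.
- apply/allP => s sD; have /andP[s0 us] := uD s sD.
  rewrite /is_path s0 us; apply: sorted_edges => e e0.
  by have := leq_trans e0 (ge s e sD); case: (_ \in _).
- have le1 e : \sum_(s <- D) ec e s <= 1 by rewrite eD; case: (_ \in _).
  elim: D le1 {uD eD ge} => //= s D IH le1; apply/andP; split; last first.
    by apply: IH => e; apply: leq_trans (le1 e); rewrite big_cons leq_addl.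
  apply/allP => t tD; apply/pred0P => e /=; rewrite !mem_path_edges.
  apply/negP => /andP[es et]; have := le1 e.
  rewrite big_cons (perm_big _ (perm_to_rem tD)) big_cons.
  move/(leq_trans (leq_add es (leq_trans et (leq_addr _ _)))).
  by rewrite ltnn.
- apply/setP => e; rewrite mem_bigcup_seq; apply/hasP/idP => [[s sD e0]|eE].
    by have := leq_trans e0 (ge s e sD); case: (_ \in _).
  apply/hasP; apply/negPn/negP; rewrite -all_predC => /allP a0.
  by have := eD e; rewrite eE big1_seq // => s /= /a0 /=; rewrite lt0n negbK => /eqP.
Qed.

Lemma path_number_le D k : decomp (edge_set X) D -> size D <= k -> path_number X <= k.
Proof.
move=> dD; apply: leq_trans; rewrite /path_number; case: ex_minnP => j _; apply.
by apply/asboolP; exists D => //; apply: decompositionP.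
Qed.

End Decompositions.

(** * Level edges and column edges of the product *)

Section ProductWeight.
Variables (G H : sgraph) (f : G -> G).
Hypotheses (fadj : forall g, adj g (f g)) (finj : injective (fun g => [set g; f g])).
Hypothesis fedge : forall g g' : G, adj g g' -> exists x, [set g; g'] = [set x; f x].
Notation X := (cart_prod G H).
Implicit Types (e : {set G * H}) (s : seq H).

Let up (g : G) (h : H) : G * H := (g, h).

Lemma imset_lift g (a b : H) : [set (g, a); (g, b)] = up g @: [set a; b] :> {set G * H}.
Proof. by rewrite imsetU1 imset_set1. Qed.

Lemma snd_lift g (A : {set H}) : snd @: (up g @: A) = A.
Proof. by rewrite -imset_comp (eq_imset _ (g := id)) // imset_id. Qed.

(** A level edge at [g] is recovered from its projection to [H]; the boolean factor tests this. *)
Lemma ec_lift e g s :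
  ec e (at_level g s) = (e == up g @: (snd @: e)) * ec (snd @: e) s.
Proof.
have [eqe|ne] := eqVneq; last first.
  apply/eqP; rewrite -leqn0 leqNgt; apply/negP => /ec_gt0[s1 [x [y [s2 [eqs eqe]]]]].
  have : (x \in at_level g s) && (y \in at_level g s) by rewrite eqs !mem_cat !inE !eqxx
    !orbT.
  rewrite !mem_lift; case: x y {eqs} eqe => [x1 x2] [y1 y2] /= eqe /andP[/andP[/eqP ex _]
    /andP[/eqP ey _]].
  by case/eqP: ne; rewrite eqe ex ey imset_lift snd_lift.
rewrite mul1n eqe snd_lift; move: (snd @: e) => A {e eqe}.
elim: s => // x [|y s] IH //; rewrite /at_level /= !ec_cons imset_lift.
by rewrite (inj_eq (imset_inj (_ : injective (up g)))) ?IH // => u v [].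
Qed.

(** Level edges project to pairs in [H] and column edges to single vertices, so no edge is counted
    in both sums; [finj] and [fedge] give each column edge exactly one lower end. *)
Lemma product_weight (ss : seq (seq H)) (hs : seq H) e :
  (forall e' : {set H}, \sum_(s <- ss) ec e' s = (e' \in edge_set H)) ->
  perm_eq hs (index_enum H) ->
  block_weight f ss hs e = (e \in edge_set X).
Proof.
move=> Ess Ehs; rewrite /block_weight (perm_big _ Ehs) /= exchange_big /=.
have -> : \sum_g \sum_(s <- ss) ec e (at_level g s) =
    \sum_g (e == up g @: (snd @: e)) * (snd @: e \in edge_set H).
  by apply: eq_bigr => g _; rewrite -Ess big_distrr; apply: eq_bigr => s _; apply: ec_lift.
have colE g h : ec e (rung f g h) = ([set (g, h); (f g, h)] == e) by exact: ec2E.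
rewrite (eq_bigr (fun h => \sum_g ([set (g, h); (f g, h)] == e : nat))); last first.
  by move=> h _; apply: eq_bigr => g _; apply: colE.
have snd_col g h : snd @: [set (g, h); (f g, h)] = [set h] :> {set H}.
  by rewrite imsetU1 imset_set1 setUid.
have fst_col g h : fst @: [set (g, h); (f g, h)] = [set g; f g] :> {set G}.
  by rewrite imsetU1 imset_set1.
have [/imsetP[[[g a] [g' b]]]|eN] := boolP (e \in edge_set X); last first.
  rewrite big1 ?big1 // => [h _|g _].
    apply: big1 => g _; case: eqP => // eqe; case/negP: eN; rewrite -eqe.
    by apply/imsetP; exists ((g, h), (f g, h)); rewrite // inE /= /cart_adj /= fadj eqxx.
  have [eqe|] := eqVneq; last by rewrite mul0n.
  rewrite mul1n; case eE : (snd @: e \in edge_set H) => //; case/negP: eN.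
  have /imsetP[[u v]] := eE; rewrite inE /= => uv euv.
  rewrite eqe euv -imset_lift; apply/imsetP; exists ((g, u), (g, v)) => //.
  by rewrite inE /= /cart_adj /= uv eqxx orbT.
rewrite inE /= /cart_adj /= => + eqe; case/orP => /andP[adj_ /eqP eq_].
- have [x ex] := fedge adj_.
  have ecol : e = [set (x, b); (f x, b)].
    have cE (u v : G) : [set (u, b); (v, b)] = pair^~ b @: [set u; v].
      by rewrite imsetU1 imset_set1.
    by rewrite eqe eq_ !cE ex.
  rewrite big1 => [|y _]; last first.
    rewrite ecol snd_col; case: (boolP ([set b] \in edge_set H)) => [/card_edge|];
      last by rewrite muln0.
    by rewrite cards1.
  rewrite (bigD1 b) //= (bigD1 x) //= -ecol eqxx big1 => [|y yx]; last first.
    rewrite ecol; case: eqP => // /(congr1 (fun A : {set G * H} => fst @: A)).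
    by rewrite !fst_col => /finj eyx; rewrite eyx eqxx in yx.
  rewrite big1 // => h hb; apply: big1 => y _; rewrite ecol.
  case: eqP => // /(congr1 (fun A : {set G * H} => snd @: A)); rewrite !snd_col.
  by move/set1_inj => ehb; rewrite ehb eqxx in hb.
- have ea : snd @: e = [set a; b] by rewrite eqe eq_ imset_lift snd_lift.
  rewrite (bigD1 g) //= ea mem_edge_set adj_ -imset_lift {1}eqe -eq_ eqxx.
  rewrite big1 => [|y yg]; last first.
    rewrite muln1 eqe -eq_; case: eqP => // /setP/(_ (g, a)).
    by rewrite !inE eqxx /= -imset_lift !inE !xpair_eqE eq_sym (negbTE yg).
  rewrite big1 // => h _; apply: big1 => y _; case: eqP => // eqc.
  have := ea; rewrite -eqc snd_col => /(congr1 (fun A : {set H} => #|A|)).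
  by rewrite cards1 cards2; case: eqP adj_ => [->|//]; rewrite adj_irrefl.
Qed.

End ProductWeight.

(** * Assembling the blocks into the bound *)

Lemma connected_incident (H : sgraph) : connected_graph H -> 1 < #|H| ->
  forall v : H, exists2 e, e \in edge_set H & v \in e.
Proof.
case=> _ conn H1 v; have [w wv] : exists w, w != v.
  case/card_gt1P: H1 => x [y [_ _ xy]].
  by have [xv|] := eqVneq x v; [exists y; rewrite -xv eq_sym | exists x].
have /connectP[[|y p] /= pp wp] := conn v w; first by rewrite wp eqxx in wv.
have /andP[vy _] := pp.
by exists [set v; y]; rewrite ?mem_edge_set // !inE eqxx.
Qed.

(** The vertices of the trails partition those of [H], so the budgets of the blocks add up to mn. In
    the excluded case the product is a triangle, which needs two paths where 3/2 are allowed. *)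
Lemma path_number_cart_prod (G H : sgraph) : unicyclic G -> 2 < #|G| ->
  connected_graph H -> ~ (#|G| = 3 /\ #|H| = 1) ->
  2 * path_number (cart_prod G H) <= #|G| * #|H|.
Proof.
move=> uG G3 cH nK; have [f [a [fadj finj reach]]] := unicyclic_orientation uG.
have f1 g : f g != g by apply: contraTneq (fadj g) => ->; rewrite adj_irrefl.
(* A 2-cycle of [f] would select the edge [{g, f g}] twice. *)
have f2 g : f (f g) != g.
  apply/eqP => ffg; have /eqP[] := f1 g; apply: finj; by rewrite ffg setUC.
have fedge (g g' : G) : adj g g' -> exists x, [set g; g'] = [set x; f x].
  (* The selected edges are distinct and as many as the vertices, hence as all the edges of [G]. *)
  have eqE : [set [set x; f x] | x : G] = edge_set G.
    apply/eqP; rewrite eqEcard uG.2 card_imset // leqnn andbT.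
    by apply/subsetP => _ /imsetP[x _ ->]; rewrite mem_edge_set.
  by rewrite -mem_edge_set -eqE => /imsetP[x _ ->]; exists x.
have /card_gt0P[h0 _] := cH.1.
have [D [dD eD bigD]] : exists D, [/\ decomp (edge_set H) D,
    forall v, 0 < path_ends h0 D v <= 2 &
    1 < #|H| -> all (fun s => 1 < size s) D].
  have [//|D dD eD] := @end_decomposition _ h0 (edge_set H) None (@card_edge H).
  have eD2 v : 0 < path_ends h0 D v <= 2 by rewrite eD /end_number /=; case: odd.
  have [H1|H1] := boolP (1 < #|H|); last by exists D; split.
  have [||D' [dD' eD' aD']] := @no_trivial_path _ h0 _ _ dD.
  - by move=> v; have /andP[] := eD2 v.
  - exact: connected_incident.
  by exists D'; split=> // v; rewrite eD'.
have [TT [trT eT bigT vT]] := trail_decomposition dD.1 eD.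
have bT t : t \in TT -> block f t (trail_vertices h0 t).
  move=> tT; have tt := allP trT t tT.
  have [fi|fni] := pselect (injective f);
    last exact: (block_trail_branching f1 f2 reach fni).
  have [G4|] := ltnP 3 #|G|; first exact: (block_trail_cycle f1 f2 reach fi G4).
  move=> G3'; have {G3'}G3 : #|G| = 3 by apply/eqP; rewrite eqn_leq G3' G3.
  apply: (block_trail_triangle a f1 f2 fi G3 tt).
    apply: (allP (bigT (bigD _)) t tT).
    (* For a triangle, [nK] forces [H] to have at least two vertices, so that trivial paths could be
       removed. *)
    by rewrite ltn_neqAle cH.1 andbT; apply/eqP => H1; apply: nK.
  apply: count_mem_uniq => v; have := vT v.
  rewrite (perm_big _ (perm_to_rem tT)) big_cons => cv.
  have : count_mem v (trail_vertices h0 t) <= 1 by rewrite -cv leq_addr.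
  by rewrite -has_pred1 has_count; case: (count_mem v _) => [|[]].
have [DD [uDD wDD sDD]] := block_flatten bT.
have pv : perm_eq (flatten [seq trail_vertices h0 t | t <- TT]) (index_enum H).
  rewrite /perm_eq; apply/allP => v _ /=; apply/eqP.
  rewrite count_flatten sumnE !big_map vT.
  by rewrite count_uniq_mem ?index_enum_uniq // mem_index_enum.
have dDD : decomp (edge_set (cart_prod G H)) DD.
  split=> // e; rewrite wDD; apply: (product_weight fadj finj fedge) pv.
  by move=> e'; rewrite -dD.2 -eT big_flatten.
have := path_number_le dDD (leqnn _); rewrite -(leq_pmul2l (isT : 0 < 2)) => le.
apply: leq_trans le (leq_trans sDD _).
by rewrite (perm_size pv) -sum1_size -(sum1_card H).
Qed.

Local Open Scope ring_scope.
Import Order.TTheory GRing.Theory Num.Theory.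

Theorem theorem5p2 (G H : sgraph) (m n : nat) :
  unicyclic G -> #|G| = m -> (3 <= m)%N ->
  connected_graph H -> #|H| = n ->
  ~ (m = 3 /\ n = 1)%N ->
  (path_number (cart_prod G H))%:R <= (m * n)%:R / 2%:R :> rat.
Proof.
move=> uG <- G3 cH <- nK; rewrite ler_pdivlMr ?ltr0n // -natrM ler_nat mulnC.
exact: path_number_cart_prod.
Qed.
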